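(* Let $D\ge1$ and let $f:\mathbb{R}^D\to\mathbb{R}$ be continuously differentiable with effective dimensionality $d_e\ge1$, attaining its global minimum $f^*$, and suppose there exists $L>0$ with $\|\nabla f(\boldsymbol{x})\|\le L$ for all $\boldsymbol{x}\in\mathbb{R}^D$. Let $\rho$ be a probability density with support the whole of $\mathbb{R}^D$. Consider the random sequences produced by the ASM-GO algorithm (see context) with accuracy $\epsilon>0$, and assume that there exists $\gamma\in(0,1]$ such that for all $k\ge1$, $$\mathbb{P}[S^k=1\mid\mathcal{F}^{k-1/2}]=\mathbb{E}[S^k\mid\mathcal{F}^{k-1/2}]\ge\gamma.$$ Then $$\lim_{k\to\infty}\mathbb{P}[\boldsymbol{x}^k_{opt}\in G_\epsilon]=\lim_{k\to\infty}\mathbb{P}[f(\boldsymbol{x}^k_{opt})\le f^*+\epsilon]=1.$$ Furthermore, for any $\xi\in(0,1)$, $$\mathbb{P}[\boldsymbol{x}^k_{opt}\in G_\epsilon]=\mathbb{P}[f(\boldsymbol{x}^k_{opt})\le f^*+\epsilon]\ge\xi\quad\text{for all }k\ge K_\xi,$$ where $$K_\xi:=\left\lceil\frac{|\log(1-\xi)|}{\tau\gamma}\right\rceil+M_0-1,\qquad \tau:=1-\exp\left(-\frac{\lambda_{d_e}^2}{4\lambda_1L^2}\right),\qquad M_0:=\left\lceil\frac{4\lambda_1L^2}{\lambda_{d_e}^2}\log(d_e)\right\rceil+1,$$ and $\lambda_1\ge\dots\ge\lambda_{d_e}$ are the $d_e$ largest eigenvalues of $\boldsymbol{C}=\int\nabla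 f(\boldsymbol{x})\nabla f(\boldsymbol{x})^T\rho(\boldsymbol{x})\,d\boldsymbol{x}$.
   Context: Effective dimensionality: $f:\mathbb{R}^D\to\mathbb{R}$ has effective dimensionality $d_e\le D$ if (i) there is a linear subspace $\mathcal{T}\subset\mathbb{R}^D$ of dimension $d_e$ such that $f(\boldsymbol{x}_\top+\boldsymbol{x}_\perp)=f(\boldsymbol{x}_\top)$ for all $\boldsymbol{x}_\top\in\mathcal{T}$, $\boldsymbol{x}_\perp\in\mathcal{T}^\perp$, and (ii) $d_e$ is the smallest integer with this property. Under the hypotheses of the claim, $\operatorname{rank}(\boldsymbol{C})=d_e$, so $\lambda_{d_e}>0$. ''$\rho$ has support the whole of $\mathbb{R}^D$'' means the measure $\rho(\boldsymbol{x})d\boldsymbol{x}$ gives positive mass to every nonempty open set. ASM-GO algorithm (all objects are random variables on a common probability space). Start from a random vector $\boldsymbol{p}^0\in\mathbb{R}^D$. For $k=1,2,\dots$: (1) draw a new sample of $k$ points $\boldsymbol{x}_S^{1},\dots,\boldsymbol{x}_S^{k}$, i.i.d. with density $\rho$ and independent of $\mathcal{F}^{k-1}$ (defined below), and form $\hat{\boldsymbol{C}}=\frac1k\sum_{j=1}^k\nabla f(\boldsymbol{x}_S^{j})\nabla f(\boldsymbol{x}_S^{j})^T$; (2) let $\boldsymbol{A}^k$ be any $D\times d_k$ matrix whose columns span $\operatorname{range}(\hat{\boldsymbol{C}})$; (3) compute $\boldsymbol{y}^k\in\mathbb{R}^{d_k}$ by solving approximately, and possibly probabilistically, the reduced problem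 $(\mathrm{RP}^k)$: $f^k_{\min}=\min_{\boldsymbol{y}\in\mathbb{R}^{d_k}}f(\boldsymbol{A}^k\boldsymbol{y}+\boldsymbol{p}^{k-1})$ (understood as an infimum if not attained); (4) set $\boldsymbol{x}^k=\boldsymbol{A}^k\boldsymbol{y}^k+\boldsymbol{p}^{k-1}$; (5) choose a (deterministic or random) vector $\boldsymbol{p}^k\in\mathbb{R}^D$. Let $\mathcal{F}^0=\sigma(\boldsymbol{p}^0)$, $\mathcal{F}^k=\sigma(\boldsymbol{A}^1,\dots,\boldsymbol{A}^k,\boldsymbol{y}^1,\dots,\boldsymbol{y}^k,\boldsymbol{p}^0,\dots,\boldsymbol{p}^k)$ and $\mathcal{F}^{k-1/2}=\sigma(\boldsymbol{A}^1,\dots,\boldsymbol{A}^k,\boldsymbol{y}^1,\dots,\boldsymbol{y}^{k-1},\boldsymbol{p}^0,\dots,\boldsymbol{p}^{k-1})$. For the fixed accuracy $\epsilon>0$, $S^k=\mathbf{1}\{f(\boldsymbol{A}^k\boldsymbol{y}^k+\boldsymbol{p}^{k-1})\le f^k_{\min}+\epsilon\}$. Also $G_\epsilon=\{\boldsymbol{x}\in\mathbb{R}^D:f(\boldsymbol{x})\le f^*+\epsilon\}$, and $\boldsymbol{x}^k_{opt}$ is a point among $\boldsymbol{x}^1,\dots,\boldsymbol{x}^k$ with the smallest value of $f$. Inequalities between conditional expectations are almost sure. *)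

(* Defs.v *)
From HB Require Import structures.
From mathcomp Require Import all_boot all_order all_algebra.
From mathcomp Require Import all_classical all_reals all_analysis.
From mathcomp Require Import measurable_realfun.

Set Implicit Arguments.
Unset Strict Implicit.
Unset Printing Implicit Defensive.

Import Order.TTheory GRing.Theory Num.Theory.
Import numFieldNormedType.Exports.

Local Open Scope classical_set_scope.
Local Open Scope ring_scope.

HB.instance Definition _ (R : realType) (m n : nat) :=
  @isMeasurable.Build (sigma_display (@open 'M[R]_(m, n))) 'M[R]_(m, n)
    <<s open >> (@sigma_algebra0 _ setT open) (@sigma_algebraC _ open)
    (@sigma_algebra_bigcup _ setT open).

Lemma measurable_mx_open {R : realType} m n (U : set 'M[R]_(m, n)) :
  open U -> measurable U.
Proof. by move=> oU; exact: sub_sigma_algebra. Qed.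

Lemma measurable_fun_mx {R : realType} d (T : measurableType d) m n
    (h : T -> 'M[R]_(m, n)) :
  (forall i j, measurable_fun setT (fun t => h t i j)) -> measurable_fun setT h.
Proof.
move=> mh; have mE : @measurable _ 'M[R]_(m, n) = <<s open >> by [].
apply: (measurability _ mE) => _ [U oU <-].
rewrite setTI.
pose B (c : 'M[rat]_(m, n) * rat) : set 'M[R]_(m, n) :=
  ball (map_mx ratr c.1 : 'M[R]_(m, n)) (ratr c.2).
have -> : h @^-1` U = \bigcup_(c in [set: 'M[rat]_(m, n) * rat])
    (if `[< B c `<=` U >] then h @^-1` B c else set0).
  apply/seteqP; split=> [t /= Uht|t [c _]]; last first.
    by case: asboolP => // BU /BU.
  have /nbhs_ballP[e /= e0 eU] : nbhs (h t) U by exact: open_nbhs_nbhs.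
  have /rat_in_itvoo[q] : (0 : R) < e / 2 by rewrite divr_gt0.
  rewrite in_itv /= => /andP[q0 qe].
  have ex i j : exists r : rat, ball (h t i j) (ratr q) (ratr r : R).
    suff : ball (h t i j) (ratr q) `&` range ratr !=set0.
      by move=> [/= _ []] /[swap] -[r _ <-]; exists r.
    apply: dense_rat; last exact: ball_open.
    by exists (h t i j); exact: ballxx.
  pose c : 'M[rat]_(m, n) := \matrix_(i, j) projT1 (cid (ex i j)).
  have cP i j : ball (h t i j) (ratr q) (ratr (c i j) : R).
    by rewrite mxE; case: cid.
  exists (c, q) => //; rewrite asboolT.
    by split=> // i j; rewrite mxE; exact/ball_sym/cP.
  move=> v [_ cv]; apply: eU; split => // i j.
  have := cv i j; rewrite mxE => ?.
  apply: (@le_ball _ _ _ (ratr q + ratr q)).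
    by rewrite (splitr e) lerD// ltW.
  exact: (ball_triangle (cP i j)).
apply: countable_bigcupT_measurable => // c; case: asboolP => // _.
have [q0|q0] := ltP (0 : R) (ratr c.2); last first.
  rewrite (_ : h @^-1` B c = set0)//.
  apply/seteqP; split => // t [+ _] => /=.
  by rewrite ltNge q0.
rewrite (_ : h @^-1` B c = \bigcap_(k in [set: 'I_m * 'I_n])
   ((fun t => h t k.1 k.2) @^-1` ball (ratr (c.1 k.1 k.2) : R) (ratr c.2))).
  apply: fin_bigcap_measurable => [|k _]; first exact: finite_finset.
  rewrite -[X in measurable X]setTI; apply: mh => //.
  exact: measurable_ball.
apply/seteqP; split => [t [_ ht] k _|t ht].
  by have := ht k.1 k.2; rewrite /= [map_mx _ _ _ _]mxE; exact.
by split => // i j; rewrite mxE; exact: (ht (i, j) I).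
Qed.

Lemma measurable_mx_entry {R : realType} m n i j :
  measurable_fun setT (fun M : 'M[R]_(m, n) => M i j).
Proof.
apply: (measurability _ (RGenOpens.measurableE R)) => _ [_ [a [b ->]] <-].
rewrite setTI; apply: measurable_mx_open.
exact: (open_comp (fun M _ => @coord_continuous R m n i j M) (interval_open _ _)).
Qed.

Section lebesgue_cV.
Context {R : realType}.

Definition cV_cons n (p : measurableTypeR R * 'cV[R]_n) : 'cV[R]_(1 + n) :=
  col_mx p.1%:M p.2.

Definition cV_uncons n (v : 'cV[R]_(1 + n)) : measurableTypeR R * 'cV[R]_n :=
  (v 0 0, dsubmx v).

Lemma cV_unconsK n : cancel (@cV_uncons n) (@cV_cons n).
Proof.
move=> v; rewrite /cV_cons/= -[RHS]vsubmxK; congr col_mx.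
apply/colP => i; rewrite !mxE ord1 eqxx mulr1n; congr (v _ _).
exact/val_inj.
Qed.

Lemma cV_consK n : cancel (@cV_cons n) (@cV_uncons n).
Proof.
move=> [x v]; rewrite /cV_uncons/cV_cons/= col_mxKd; congr pair.
by rewrite mxE; case: splitP => // j _; rewrite ord1 mxE eqxx mulr1n.
Qed.

Lemma measurable_cV_cons n : measurable_fun setT (@cV_cons n).
Proof.
apply: measurable_fun_mx => i j; rewrite /cV_cons.
under eq_fun do rewrite mxE.
case: (fintype.split i) => k.
  under eq_fun do rewrite !ord1 mxE eqxx mulr1n.
  exact: measurable_fst.
exact: (measurableT_comp (measurable_mx_entry k j) measurable_snd).
Qed.

Lemma measurable_cV_uncons n : measurable_fun setT (@cV_uncons n).
Proof.
apply: measurable_fun_pair; first exact: measurable_mx_entry.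
apply: measurable_fun_mx => i j; under eq_fun do rewrite mxE.
exact: measurable_mx_entry.
Qed.

Section cons_measure.
Variables (n : nat) (m : {sigma_finite_measure set 'cV[R]_n -> \bar R}).

Definition lebesgue_cV_cons : set 'cV[R]_(1 + n) -> \bar R :=
  pushforward (lebesgue_measure \x m)%E (@cV_cons n).

Let lebesgue_cV_cons0 : lebesgue_cV_cons set0 = 0%E.
Proof. by rewrite /lebesgue_cV_cons /pushforward preimage_set0 measure0. Qed.

Let lebesgue_cV_cons_ge0 A : (0 <= lebesgue_cV_cons A)%E.
Proof. by rewrite /lebesgue_cV_cons /pushforward; exact: measure_ge0. Qed.

Let lebesgue_cV_cons_sigma_additive : semi_sigma_additive lebesgue_cV_cons.
Proof.
have mF' (B : set 'cV[R]_(1 + n)) : measurable B ->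
    measurable (@cV_cons n @^-1` B).
  by move=> mB; rewrite -[X in measurable X]setTI; exact: measurable_cV_cons.
move=> F mF tF mUF; rewrite /lebesgue_cV_cons /pushforward preimage_bigcup.
apply: measure_semi_sigma_additive.
- by move=> k; exact: mF'.
- apply/trivIsetP => /= i j _ _ ij; rewrite -preimage_setI.
  by move/trivIsetP : tF => /(_ _ _ _ _ ij) ->//; rewrite preimage_set0.
- by rewrite -preimage_bigcup; exact: mF'.
Qed.

HB.instance Definition _ := isMeasure.Build _ _ _ lebesgue_cV_cons
  lebesgue_cV_cons0 lebesgue_cV_cons_ge0 lebesgue_cV_cons_sigma_additive.

Lemma lebesgue_cV_cons_sigma_finite : sigma_finite setT lebesgue_cV_cons.
Proof.
have /sigma_finiteP[F [TF ndF Foo]] := sigma_finiteT (@lebesgue_measure R).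
have /sigma_finiteP[G [TG ndG Goo]] := sigma_finiteT m.
exists (fun k => @cV_uncons n @^-1` (F k `*` G k)).
  apply/esym; rewrite -subTset => v _.
  have : [set: measurableTypeR R] (cV_uncons v).1 by [].
  have : [set: 'cV[R]_n] (cV_uncons v).2 by [].
  rewrite TF TG => -[k _ Gk] [l _ Fl]; exists (maxn k l) => //; split.
    by move: Fl; exact/subsetPset/ndF/leq_maxr.
  by move: Gk; exact/subsetPset/ndG/leq_maxl.
move=> k; have [[mF Fk] [mG Gk]] := (Foo k, Goo k); split.
  rewrite -[X in measurable X]setTI; apply: measurable_cV_uncons => //.
  exact: measurableX.
rewrite /lebesgue_cV_cons /pushforward -comp_preimage.
rewrite (_ : _ \o _ = id); last by apply/funext => p /=; rewrite cV_consK.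
by rewrite preimage_id product_measure1E// lte_mul_pinfty// ge0_fin_numE.
Qed.

HB.instance Definition _ :=
  Measure_isSigmaFinite.Build _ _ _ lebesgue_cV_cons
    lebesgue_cV_cons_sigma_finite.

End cons_measure.

(* Lebesgue measure on R^n as an iterated product; its values on boxes are
   computed in lebesgue_cV_box. *)
Fixpoint lebesgue_cV n : {sigma_finite_measure set 'cV[R]_n -> \bar R} :=
  if n is n'.+1 then lebesgue_cV_cons (lebesgue_cV n')
  else \d_(0 : 'cV[R]_0).

Lemma measurable_cV_box n (a b : 'I_n -> R) :
  measurable [set v : 'cV[R]_n | forall i, a i < v i 0 <= b i].
Proof.
rewrite (_ : [set _ | _] = \bigcap_(i in [set: 'I_n])
    ((fun v : 'cV[R]_n => v i 0) @^-1` `]a i, b i])).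
  apply: fin_bigcap_measurable => [|i _]; first exact: finite_finset.
  rewrite -[X in measurable X]setTI; apply: (measurable_mx_entry i 0) => //;
    exact: (measurable_itv `]a i, b i]).
apply/seteqP; split => [v vab i _|v vab i] /=; first by rewrite in_itv/= vab.
by have := vab i I; rewrite /= in_itv.
Qed.

Lemma lebesgue_cV_box n (a b : 'I_n -> R) : (forall i, a i <= b i) ->
  lebesgue_cV n [set v | forall i, a i < v i 0 <= b i] =
  (\prod_i (b i - a i))%:E.
Proof.
elim: n => [|n IH] in a b *.
  by move=> _; rewrite big_ord0 /= diracE mem_set//= => -[].
move=> ab; rewrite big_ord_recl EFinM /= /lebesgue_cV_cons /pushforward.
rewrite (_ : _ @^-1` _ = `]a ord0, b ord0] `*`
    [set v : 'cV[R]_n | forall i, a (lift ord0 i) < v i 0 <= b (lift ord0 i)]).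
  rewrite product_measure1E//=; last exact: measurable_cV_box.
  rewrite IH// lebesgue_measure_itv/= lte_fin; case: ltP => [_|ba].
    by rewrite EFinB.
  by have /eqP -> : b ord0 == a ord0 by [rewrite eq_le ba ab]; rewrite subrr.
have c0 (p : measurableTypeR R * 'cV[R]_n) : cV_cons p ord0 0 = p.1.
  exact: (congr1 fst (cV_consK p)).
have cS (p : measurableTypeR R * 'cV[R]_n) i : cV_cons p (lift ord0 i) 0 = p.2 i 0.
  rewrite /cV_cons -(col_mxEd p.1%:M p.2 i 0).
  by congr (col_mx _ _ _ _); exact/val_inj.
apply/seteqP; split => [p pab|p [/= p0 pS] i] /=.
  split => [|i]; first by have := pab ord0; rewrite c0 in_itv.
  by have := pab (lift ord0 i); rewrite cS.
move: p0; rewrite in_itv/=.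
by case: (unliftP ord0 i) => [j ->|->]; rewrite ?cS ?c0.
Qed.

End lebesgue_cV.

Section objective.
Context {R : realType} {D : nat}.
Implicit Types (f rho : 'cV[R]_D -> R) (u v x : 'cV[R]_D).

Definition dotv u v : R := \sum_i u i 0 * v i 0.

(* The library's norm on matrices is the sup norm. *)
Definition enorm v : R := Num.sqrt (dotv v v).

Definition grad f x : 'cV[R]_D := \col_i 'D_(delta_mx i 0) f x.

Definition C1 f := (forall x, differentiable f x) /\ continuous (grad f).

Definition orthogonal_complement (T : {vspace 'cV[R]_D}) : set 'cV[R]_D :=
  [set v | forall u, u \in T -> dotv u v = 0].

Definition depends_on_subspace f (n : nat) := exists T : {vspace 'cV[R]_D},
  \dim T = n /\
  forall x v, x \in T -> orthogonal_complement T v -> f (x + v) = f x.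

Definition effective_dim f (n : nat) :=
  depends_on_subspace f n /\ forall n', depends_on_subspace f n' -> (n <= n')%N.

Definition global_min f (fstar : R) :=
  (exists x, f x = fstar) /\ forall x, fstar <= f x.

Definition sublevel f (c : R) : set 'cV[R]_D := [set x | f x <= c].

Definition prob_density rho :=
  [/\ measurable_fun setT rho, forall x, 0 <= rho x &
      (\int[lebesgue_cV D]_x (rho x)%:E)%E = 1%E].

Definition full_support rho := forall U : set 'cV[R]_D,
  open U -> U !=set0 -> (0 < \int[lebesgue_cV D]_(x in U) (rho x)%:E)%E.

Definition grad_cov f rho : 'M[R]_D := \matrix_(i, j)
  \int[lebesgue_cV D]_x ((grad f x *m (grad f x)^T) i j * rho x).

Definition spectrum (M : 'M[R]_D) (lam : seq R) :=
  sorted >=%R lam /\ char_poly M = \prod_(l <- lam) ('X - l%:P).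

End objective.

Section probability.
Context d (Omega : measurableType d) (R : realType) (P : probability Omega R).

Definition sigma_gen (T : topologicalType) (X : Omega -> T) : set_system Omega :=
  <<s preimage_set_system setT X open >>.

Definition independent_family (I : finType) (G : I -> set_system Omega) :=
  forall (J : {set I}) (E : I -> set Omega), (forall i, i \in J -> G i (E i)) ->
    P (\bigcap_(i in [set` J]) E i) = (\prod_(i in J) P (E i))%E.

Definition independent2 (G H : set_system Omega) :=
  forall E F, G E -> H F -> P (E `&` F) = (P E * P F)%E.

Definition has_density D (X : {RV P >-> 'cV[R]_D}) (rho : 'cV[R]_D -> R) :=
  forall B, measurable B ->
    distribution P X B = (\int[lebesgue_cV D]_(x in B) (rho x)%:E)%E.

(* Z is a version of E[X | G], for G a sub-sigma-algebra. *)
Definition cond_expectation (G : set_system Omega) (X Z : Omega -> R) :=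
  [/\ P.-integrable setT (EFin \o X),
      P.-integrable setT (EFin \o Z),
      forall B : set R, measurable B -> G (Z @^-1` B) &
      forall E, G E ->
        (\int[P]_(w in E) (Z w)%:E = \int[P]_(w in E) (X w)%:E)%E].

Definition cond_probability (G : set_system Omega) (E : set Omega)
  (Z : Omega -> R) := cond_expectation G \1_E Z.

End probability.

Section asm_go.
Context d (Omega : measurableType d) (R : realType) (P : probability Omega R).
Variable D : nat.

(* Iterations are numbered from 1; the entries at 0 of the sequences other than
   asm_p are unused. The number of columns of A^k is itself random. *)
Record asm_data := ASMData {
  asm_sample : forall k, 'I_k -> {RV P >-> 'cV[R]_D};
  asm_dim : nat -> Omega -> nat;
  asm_A : forall k w, 'M[R]_(D, asm_dim k w);
  asm_y : forall k w, 'cV[R]_(asm_dim k w);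
  asm_p : nat -> {RV P >-> 'cV[R]_D}
}.

Variables (f rho : 'cV[R]_D -> R) (s : asm_data).

(* A^k and y^k as random elements of the disjoint unions over n of the spaces
   of D x n matrices and of n-vectors, with the disjoint union topology. *)
Definition tagged_A k (w : Omega) : {n : nat & 'M[R]_(D, n)} :=
  existT (fun n => 'M[R]_(D, n)) (asm_dim s k w) (asm_A s k w).

Definition tagged_y k (w : Omega) : {n : nat & 'cV[R]_n} :=
  existT (fun n => 'cV[R]_n) (asm_dim s k w) (asm_y s k w).

Definition sigma_history (a b c : nat) : set_system Omega :=
  <<s \bigcup_(i in [set i | (1 <= i <= a)%N]) sigma_gen (tagged_A i) `|`
      \bigcup_(i in [set i | (1 <= i <= b)%N]) sigma_gen (tagged_y i) `|`
      \bigcup_(i in [set i | (i <= c)%N]) sigma_gen (asm_p s i) >>.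

Definition F_full k := sigma_history k k k.

(* The half-step history: A^k is already known, y^k and p^k are not. *)
Definition F_half k := sigma_history k k.-1 k.-1.

Definition sigma_sample k : set_system Omega :=
  <<s \bigcup_(j in [set: 'I_k]) sigma_gen (asm_sample s j) >>.

Definition C_hat k (w : Omega) : 'M[R]_D :=
  k%:R^-1 *: \sum_(j < k)
    (grad f (asm_sample s j w) *m (grad f (asm_sample s j w))^T).

Definition asm_x k (w : Omega) : 'cV[R]_D :=
  asm_A s k w *m asm_y s k w + asm_p s k.-1 w.

Definition fmin k (w : Omega) : R :=
  inf (range (fun y : 'cV[R]_(asm_dim s k w) =>
    f (asm_A s k w *m y + asm_p s k.-1 w))).

Definition success (eps : R) k : Omega -> R :=
  \1_[set w | f (asm_x k w) <= fmin k w + eps].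

(* Transposes, because %MS compares row spaces: the columns of A^k span the
   range of C_hat. Nothing is required of y^k and p^k besides measurability. *)
Record asm_go : Prop := ASMGo {
  asm_A_measurable : forall k, (0 < k)%N ->
    sigma_gen (tagged_A k) `<=` measurable;
  asm_y_measurable : forall k, (0 < k)%N ->
    sigma_gen (tagged_y k) `<=` measurable;
  asm_sample_density : forall k (j : 'I_k), has_density (asm_sample s j) rho;
  asm_sample_independent : forall k,
    independent_family P (fun j : 'I_k => sigma_gen (asm_sample s j));
  asm_sample_past : forall k, (0 < k)%N ->
    independent2 P (sigma_sample k) (F_full k.-1);
  asm_A_range : forall k w, (0 < k)%N ->
    ((asm_A s k w)^T :=: (C_hat k w)^T)%MS
}.

Definition best_iterate (xopt : nat -> Omega -> 'cV[R]_D) :=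
  forall k w, (0 < k)%N ->
    (exists2 i, (1 <= i <= k)%N & xopt k w = asm_x i w) /\
    forall i, (1 <= i <= k)%N -> f (xopt k w) <= f (asm_x i w).

End asm_go.

Section constants.
Context {R : realType}.
Variables (lam : seq R) (de : nat) (L gamma : R).

(* lam is indexed from 0, the eigenvalues from 1. *)
Let lam1 := lam`_0.
Let lamde := lam`_de.-1.

Definition tau : R := 1 - expR (- (lamde ^+ 2 / (4 * lam1 * L ^+ 2))).

Definition M0 : int :=
  Num.ceil (4 * lam1 * L ^+ 2 / lamde ^+ 2 * ln (de%:R : R)) + 1.

Definition K_xi (xi : R) : int :=
  Num.ceil (`|ln (1 - xi)| / (tau * gamma)) + M0 - 1.

End constants.

(* Main.v *)
Require Import Defs.
From HB Require Import structures.
From mathcomp Require Import all_boot all_order all_algebra.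
From mathcomp Require Import complex.
From mathcomp Require Import all_classical all_reals all_analysis.
From mathcomp Require Import measurable_realfun.
From mathcomp Require Import ring lra zify.

Set Implicit Arguments.
Unset Strict Implicit.
Unset Printing Implicit Defensive.

Import Order.TTheory GRing.Theory Num.Theory.
Import numFieldNormedType.Exports.

Local Open Scope classical_set_scope.
Local Open Scope ring_scope.

(** By continuity and full support, the kernel of C is exactly the space of
directions along which f is invariant, so rank C = d_e; hence, as soon as the
sampled gradients of step k span the range of C, the reduced problem has the
same infimum as f, and a successful solve puts x^k in G_eps.

The probability that k sampled gradients fail to span is bounded without matrix
concentration.  Let Pi_j be the orthogonal projection onto the complement of
the first j gradients.  A new gradient g lowers tr Pi_j by 1 unless Pi_j g = 0,
hence always by at least |Pi_j g|^2 / L^2, whose mean given the past is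
tr (Pi_j C) / L^2 >= (lambda_{d_e} / L^2) (tr Pi_j - (D - d_e)).  So the mean of
the nonnegative excess tr Pi_j - (D - d_e), which is at least 1 when the span is
too small, decays from d_e at rate exp (- lambda_{d_e} / L^2); this beats
exp (- lambda_{d_e}^2 / (4 lambda_1 L^2)) because lambda_{d_e} <= lambda_1.

The event B_k that x^1, ..., x^k all miss G_eps belongs to F^k, the new sample
is independent of F^{k-1}, and conditioning on F^{k-1/2} gives
P(B_k) <= P(B_{k-1}) (1 - gamma P(rank = d_e)) <= P(B_{k-1}) (1 - gamma tau) once
k >= M_0. *)

(** * Deflation of orthogonal projections *)

Section euclidean.
Context {R : realType} {D : nat}.
Implicit Types (u v x : 'cV[R]_D) (Q M : 'M[R]_D).

Lemma dotvE u v : dotv u v = (u^T *m v) 0 0.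
Proof. by rewrite mxE; apply: eq_bigr => i _; rewrite mxE. Qed.

Lemma dotvv_ge0 u : 0 <= dotv u u.
Proof. by apply: sumr_ge0 => i _; rewrite -expr2 sqr_ge0. Qed.

Lemma dotvv_eq0 u : (dotv u u == 0) = (u == 0).
Proof.
apply/eqP/eqP => [|->]; last by rewrite /dotv big1 // => i _; rewrite mxE mul0r.
move=> /eqP; rewrite psumr_eq0 => [/allP u0|i _]; last by rewrite -expr2 sqr_ge0.
apply/colP => i; rewrite mxE; apply/eqP.
by have := u0 i (mem_index_enum i); rewrite -expr2 sqrf_eq0.
Qed.

Lemma dotv_sq_le_norm u i : u i 0 ^+ 2 <= dotv u u.
Proof.
rewrite /dotv (bigD1 i) //= -expr2 lerDl sumr_ge0 // => j _.
by rewrite -expr2 sqr_ge0.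
Qed.

Lemma mxtrace_outer u : \tr (u *m u^T) = dotv u u.
Proof. by rewrite mxtrace_mulC dotvE [\tr _]big_ord1. Qed.

Definition orth_proj Q := Q^T = Q /\ Q *m Q = Q.

Lemma orth_proj1 : orth_proj 1%:M.
Proof. by split; rewrite ?trmx1 ?mulmx1. Qed.

Lemma orth_projC Q : orth_proj Q -> orth_proj (1%:M - Q).
Proof.
move=> [Qs Qi]; split; first by rewrite linearB /= trmx1 Qs.
by rewrite mulmxBr mulmx1 mulmxBl mul1mx Qi subrr subr0.
Qed.

Lemma orth_proj_dotv Q u : orth_proj Q -> dotv (Q *m u) (Q *m u) = dotv u (Q *m u).
Proof. by move=> [Qs Qi]; rewrite !dotvE trmx_mul Qs -mulmxA [Q *m (Q *m _)]mulmxA Qi. Qed.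

Lemma orth_proj_dotv_le Q u : orth_proj Q -> dotv (Q *m u) (Q *m u) <= dotv u u.
Proof.
move=> Qp; rewrite orth_proj_dotv // -subr_ge0.
have -> : dotv u u - dotv u (Q *m u) = dotv u ((1%:M - Q) *m u).
  by rewrite !dotvE mulmxBl mul1mx mulmxBr [RHS]mxE; congr (_ + _); rewrite [RHS]mxE.
by rewrite -orth_proj_dotv ?dotvv_ge0 //; exact: orth_projC.
Qed.

(** Column b of Q is the image of a unit vector, so its squared length, and with it each squared
    entry, is at most 1. This makes the entries of random projections integrable. *)
Lemma orth_proj_bounded Q a b : orth_proj Q -> `|Q a b| <= 1.
Proof.
move=> Qp; have := orth_proj_dotv_le (delta_mx b 0) Qp.
rewrite -colE => /(le_trans (dotv_sq_le_norm _ a)); rewrite mxE.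
rewrite [X in _ <= X](_ : _ = 1); last first.
  rewrite /dotv (bigD1 b) //= !mxE !eqxx mulr1 big1 ?addr0 // => i ib.
  by rewrite mxE (negbTE ib) mul0r.
by move=> h; rewrite -(@ler_pXn2r _ 2%N) ?nnegrE // real_normK ?num_real // expr1n.
Qed.

(* For g outside the kernel of the projection Q, this is the projection onto
   the orthogonal of g in the range of Q; otherwise 0^-1 = 0 leaves Q as is. *)
Definition deflate Q g : 'M[R]_D :=
  Q - (dotv (Q *m g) (Q *m g))^-1 *: ((Q *m g) *m (Q *m g)^T).

Lemma orth_proj_deflate Q g : orth_proj Q -> orth_proj (deflate Q g).
Proof.
move=> Qp; have [Qs Qi] := Qp.
have [h0|h0] := eqVneq (Q *m g) 0.
  by rewrite /deflate h0 mul0mx scaler0 subr0.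
rewrite /deflate; set h := Q *m g; set c := (dotv h h)^-1.
have hh : h^T *m h = (dotv h h)%:M by rewrite [LHS]mx11_scalar dotvE.
have hn0 : dotv h h != 0 by rewrite dotvv_eq0.
have Qh : Q *m h = h by rewrite mulmxA Qi.
have hQ : h^T *m Q = h^T by rewrite -[X in _ *m X]Qs -trmx_mul Qh.
split; first by rewrite linearB linearZ /= trmx_mul trmxK Qs.
set M := h *m h^T.
have QM : Q *m M = M by rewrite mulmxA Qh.
have MQ : M *m Q = M by rewrite -mulmxA hQ.
have MM : M *m M = dotv h h *: M.
  by rewrite mulmxA -[h *m h^T *m h]mulmxA hh mul_mx_scalar -scalemxAl.
rewrite mulmxBr !mulmxBl -!scalemxAr -!scalemxAl Qi QM MQ MM.
by rewrite !scalerA -mulrA mulVf // mulr1 subrr subr0.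
Qed.

(** Since Q is a symmetric idempotent, g . Qg = |Qg|^2, so the subtracted rank-one term sends g
    exactly to Qg. *)
Lemma deflate_mul Q g : orth_proj Q -> deflate Q g *m g = 0.
Proof.
move=> Qp; rewrite /deflate mulmxBl -scalemxAl.
have hg : (Q *m g)^T *m g = (dotv (Q *m g) (Q *m g))%:M.
  by rewrite orth_proj_dotv // [LHS]mx11_scalar dotvE !trmx_mul Qp.1 mulmxA.
move: hg; set h := Q *m g => hg; rewrite -[h *m _ *m g]mulmxA hg.
rewrite mul_mx_scalar scalerA; have [->|h0] := eqVneq h 0.
  by rewrite scaler0 subrr.
by rewrite mulVf ?dotvv_eq0 // scale1r subrr.
Qed.

Lemma deflate_ker Q g u : orth_proj Q -> Q *m u = 0 -> deflate Q g *m u = 0.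
Proof.
move=> [Qs _] Qu; rewrite /deflate mulmxBl Qu sub0r -scalemxAl trmx_mul Qs.
by rewrite -!mulmxA Qu !mulmx0 scaler0 oppr0.
Qed.

(** The normalized outer product of a nonzero vector has trace 1; for Qg = 0 nothing is
    subtracted. *)
Lemma mxtrace_deflate Q g :
  \tr (deflate Q g) = \tr Q - (Q *m g != 0)%:R.
Proof.
rewrite /deflate raddfB /= mxtraceZ mxtrace_outer; congr (_ - _).
have [->|h0] := eqVneq (Q *m g) 0; last by rewrite mulVf ?dotvv_eq0.
by rewrite [dotv _ _](_ : _ = 0) ?mulr0 //; apply/eqP; rewrite dotvv_eq0.
Qed.

(** A drop of 1 is at least |Qg|^2 / L^2 because |Qg| <= |g| <= L. The indicator of Qg != 0 thus
    gives way to a quadratic form in g, whose mean is computable from C. *)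
Lemma mxtrace_deflate_le Q g L : orth_proj Q -> 0 < L -> enorm g <= L ->
  \tr (deflate Q g) <= \tr Q - L ^- 2 * dotv g (Q *m g).
Proof.
move=> Qp L0 gL; rewrite mxtrace_deflate lerD2l lerN2 -orth_proj_dotv //.
have [->|h0] /= := eqVneq (Q *m g) 0.
  by rewrite [dotv _ _](_ : _ = 0) ?mulr0 //; apply/eqP; rewrite dotvv_eq0.
rewrite mulrC ler_pdivrMr ?exprn_gt0 // mul1r.
apply: (le_trans (orth_proj_dotv_le g Qp)).
by rewrite -(sqr_sqrtr (dotvv_ge0 g)) ler_pXn2r // nnegrE ?sqrtr_ge0 // ltW.
Qed.

(** Gram-Schmidt in terms of projections: this projects onto the orthogonal complement of the first
    k vectors. *)
Fixpoint deflation (v : nat -> 'cV[R]_D) k : 'M[R]_D :=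
  if k is k'.+1 then deflate (deflation v k') (v k') else 1%:M.

Implicit Types (vs : nat -> 'cV[R]_D).

Lemma orth_proj_deflation vs k : orth_proj (deflation vs k).
Proof.
elim: k => [|k IH] /=; [exact: orth_proj1|exact: orth_proj_deflate].
Qed.

Lemma deflation_ker vs k j : (j < k)%N -> deflation vs k *m vs j = 0.
Proof.
elim: k => // k IH; rewrite ltnS leq_eqVlt => /orP[/eqP ->|jk] /=.
  exact/deflate_mul/orth_proj_deflation.
by apply: deflate_ker (IH jk); exact: orth_proj_deflation.
Qed.

Definition span_seq (vs : nat -> 'cV[R]_D) k : 'M[R]_D := (\sum_(j < k) <<(vs j)^T>>)%MS.

(** The trace drops by 1 only when the new vector is outside the kernel of the current projection;
    that kernel contains the span of the earlier vectors, so the rank of the span then grows by at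
    least 1. *)
Lemma mxtrace_deflation_ge vs k :
  D%:R - (\rank (span_seq vs k))%:R <= \tr (deflation vs k) :> R.
Proof.
elim: k => [|k IH] /=; first by rewrite mxtrace1 lerBlDr lerDl.
rewrite mxtrace_deflate /span_seq big_ord_recr /=.
have [h0|h0] /= := eqVneq (deflation vs k *m vs k) 0.
  by rewrite subr0; apply: le_trans IH; rewrite lerD2l lerN2 ler_nat mxrankS // addsmxSl.
have : (\rank (span_seq vs k) < \rank (span_seq vs k + <<(vs k)^T>>)%MS)%N.
  (* If the span did not grow, the new vector would be a combination of earlier ones, all killed by
     the projection. *)
  apply: rank_ltmx; rewrite ltmxE addsmxSl /=; apply: contra h0 => vk.
  have /submxP[B vB] : ((vs k)^T <= span_seq vs k)%MS.
    by apply: submx_trans vk; rewrite (submx_trans _ (addsmxSr _ _)) ?genmxE.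
  have : (span_seq vs k <= kermx (deflation vs k))%MS.
    apply/sumsmx_subP => j _; rewrite genmxE; apply/sub_kermxP.
    by rewrite -{1}(orth_proj_deflation vs k).1 -trmx_mul deflation_ker // trmx0.
  move=> /sub_kermxP sk; rewrite -[_ *m vs k]trmxK trmx_mul vB.
  by rewrite (orth_proj_deflation vs k).1 -mulmxA sk mulmx0 trmx0.
rewrite -(ler_nat R) -natr1 /span_seq => ?; lra.
Qed.

End euclidean.

(** * Traces against a positive semidefinite matrix *)

(** The nonzero rows are multiples of distinct basis vectors, which gives the upper bound for every
    diagonal. The lower bound follows from subadditivity of the rank, by completing the diagonal to
    an invertible one. *)
Lemma mxrank_diag (F : fieldType) n (d : 'rV[F]_n) :
  \rank (diag_mx d) = #|[pred i | d 0 i != 0]|.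
Proof.
have ub (e : 'rV[F]_n) : (\rank (diag_mx e) <= #|[pred i | (e 0 i != 0)%R]|)%N.
  have : (diag_mx e <= \sum_(i | (e 0 i != 0)%R) <<delta_mx (0%R : 'I_1) i>>)%MS.
    apply/row_subP => i; rewrite row_diag_mx.
    have [->|ei] := eqVneq (e 0 i) 0; first by rewrite scale0r sub0mx.
    by rewrite (sumsmx_sup i) // genmxE scalemx_sub.
  move=> /mxrankS /leq_trans; apply.
  rewrite -sum1_card.
  apply: (big_rec2 (fun (A : 'M[F]_n) r => \rank A <= r)%N); first by rewrite mxrank0.
  move=> i r A _ IH; apply: leq_trans (mxrank_adds_leqif _ _).1 _.
  by rewrite leq_add // genmxE rank_leq_row.
apply/eqP; rewrite eqn_leq ub /=.
(* This diagonal fills exactly the zeros of d with ones. *)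
pose e : 'rV[F]_n := \row_i (d 0 i == 0)%:R.
have de : \rank (diag_mx d + diag_mx e)%R = n.
  apply: mxrank_unit; rewrite unitmxE unitfE.
  have -> : diag_mx d + diag_mx e = diag_mx (d + e) by rewrite raddfD.
  rewrite det_diag; apply/prodf_neq0 => i _; rewrite !mxE.
  by have [->|di] := eqVneq (d 0 i) 0; rewrite ?eqxx ?add0r ?oner_eq0 ?addr0 ?(negbTE di).
have := leq_trans (mxrank_add (diag_mx d) (diag_mx e)) (leq_add (leqnn _) (ub e)).
rewrite de (eq_card (B := [predC [pred i | d 0 i != 0]])); last first.
  by move=> i; rewrite !inE mxE negbK; case: (d 0 i == 0); rewrite ?oner_eq0 ?eqxx.
have := cardC [pred i | d 0 i != 0]; rewrite card_ord => {1}<-.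
by rewrite leq_add2r.
Qed.

Section spectrum_bound.
Context {R : realType} {D : nat}.
Implicit Types (C Q : 'M[R]_D) (lam : seq R).
Local Open Scope sesquilinear_scope.

Lemma spectrum_ge0 C lam : (forall v, 0 <= dotv v (C *m v)) -> C^T = C ->
  spectrum C lam -> forall l, l \in lam -> 0 <= l.
Proof.
move=> psd Cs [_ pC] l llam.
have : root (char_poly C) l by rewrite pC root_prod_XsubC.
rewrite -eigenvalue_root_char => /eigenvalueP[v vC v0].
have := psd v^T; rewrite -[C *m _]trmxK trmx_mul trmxK Cs vC linearZ /=.
rewrite dotvE -scalemxAr mxE -dotvE pmulr_lge0 //.
by rewrite lt_neqAle dotvv_ge0 andbT eq_sym dotvv_eq0 trmx_eq0.
Qed.

(** Viewed over the complex numbers, a real symmetric matrix is Hermitian, hence normal, and is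
    diagonalized by a unitary matrix. Comparing characteristic polynomials identifies the
    diagonal. *)
Lemma spectral_decomposition C lam : C^T = C -> spectrum C lam ->
  exists (U : 'M[R[i]]_D) (sp : 'rV[R]_D),
    [/\ U \is unitarymx,
      map_mx (real_complex R) C =
        invmx U *m diag_mx (map_mx (real_complex R) sp) *m U &
      perm_eq [seq sp 0 i | i <- enum 'I_D] lam].
Proof.
move=> Cs [_ pC]; set CC := map_mx _ C.
have /orthomx_spectralP CE : CC \is normalmx.
  apply: symmetric_normalmx.
    by apply/is_hermitianmxP; rewrite expr0 scale1r map_mx_id // map_trmx Cs.
  by apply/mxOverP => i j; rewrite mxE complex_real.
set U := spectralmx CC in CE; set sp := spectral_diag CC in CE.
have UU : U \in unitmx by exact: spectral_unit.
have pE : char_poly CC = \prod_(i <- [seq sp 0 i | i <- enum 'I_D]) ('X - i%:P).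
  have -> : char_poly CC = char_poly (diag_mx sp).
    rewrite /char_poly; have -> : char_poly_mx CC =
        map_mx polyC (invmx U) *m char_poly_mx (diag_mx sp) *m map_mx polyC U.
      rewrite /char_poly_mx mulmxBr mulmxBl -!map_mxM -CE; congr (_ - _).
      by rewrite scalar_mxC -mulmxA -map_mxM mulVmx // map_mx1 mulmx1.
    by rewrite !det_mulmx mulrAC -det_mulmx -map_mxM mulVmx // map_mx1 det1 mul1r.
  rewrite char_poly_trig ?diag_mx_is_trig // big_map big_enum.
  by apply: eq_bigr => i _; rewrite mxE eqxx.
(* Both polynomials are products of linear factors, so their roots agree up to order; in particular
   the complex spectrum is real. *)
have : perm_eq [seq sp 0 i | i <- enum 'I_D] (map (real_complex R) lam).
  apply: prod_XsubC_eq; rewrite -pE -map_char_poly pC big_map.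
  rewrite rmorph_prod /=; apply: eq_bigr => l _.
  exact: map_polyXsubC.
move=> pm; exists U, (map_mx (@complex.Re R) sp).
have spR i : (complex.Re (sp 0 i))%:C%C = sp 0 i.
  have : sp 0 i \in map (real_complex R) lam.
    by rewrite -(perm_mem pm) map_f // mem_enum.
  by move=> /mapP[l _ ->].
split; first exact: spectral_unitarymx.
  rewrite -/CC (_ : map_mx _ (map_mx _ sp) = sp) -?CE //.
  by apply/rowP => i; rewrite !mxE spR.
apply: (perm_map_inj (@complexI R)); apply: perm_trans pm.
rewrite -map_comp; rewrite (eq_map (g := fun i => sp 0 i)) // => i /=.
by rewrite mxE spR.
Qed.

(** The list is nonincreasing and nonnegative, so its [de] nonzero entries come first and the one at
    index [de.-1] is the smallest of them. *)
Lemma spectrum_nth_min C lam de : (forall v, 0 <= dotv v (C *m v)) -> C^T = C ->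
  spectrum C lam -> (0 < de)%N -> count (predC1 (0%R : R)) lam = de ->
  [/\ 0 < lam`_de.-1, lam`_de.-1 <= lam`_0 &
      forall l, l \in lam -> l != 0 -> lam`_de.-1 <= l].
Proof.
move=> psd Cs slam de0 cnt; have lam0 := spectrum_ge0 psd Cs slam.
have [srt _] := slam.
have nth_ge i j : (i <= j)%N -> (j < size lam)%N -> lam`_j <= lam`_i.
  move=> ij jn; have il : (i < size lam)%N by exact: leq_ltn_trans jn.
  by apply: (sorted_leq_nth _ _ 0 srt) => //; [exact: rev_trans le_trans|exact: lexx].
have desz : (de.-1 < size lam)%N.
  by rewrite prednK // -cnt count_size.
(* Were this entry zero, all later ones would vanish too, leaving at most [de.-1] nonzero
   entries. *)
have dep : 0 < lam`_de.-1.
  rewrite lt_neqAle lam0 ?mem_nth // andbT eq_sym; apply/eqP => z.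
  have : (count (predC1 (0%R : R)) lam <= de.-1)%N.
    rewrite -(cat_take_drop de.-1 lam) count_cat.
    have -> : count (predC1 (0%R : R)) (drop de.-1 lam) = 0%N.
      apply/eqP; rewrite -leqn0 leqNgt -has_count; apply/hasPn => l.
      move=> /(nthP 0)[n]; rewrite size_drop => il <-; rewrite nth_drop negbK.
      have il' : (de.-1 + n < size lam)%N by rewrite -ltn_subRL.
      by have := nth_ge _ _ (leq_addr n de.-1) il'; rewrite z eq_le lam0 ?mem_nth // => ->.
    by rewrite addn0 (leq_trans (count_size _ _)) // size_take_min geq_minl.
  by rewrite cnt -{1}(prednK de0) ltnn.
split => //; first exact: nth_ge.
move=> l /(nthP 0)[i il <-] l0.
have [ide|ide] := leqP i de.-1; first exact: nth_ge.
(* A nonzero entry at an index i >= de would force the first i + 1 > de entries to be nonzero. *)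
have : (i.+1 <= count (predC1 (0%R : R)) lam)%N.
  rewrite -(cat_take_drop i.+1 lam) count_cat.
  have -> : count (predC1 (0%R : R)) (take i.+1 lam) = i.+1.
    rewrite -[RHS](@size_takel i.+1 _ lam) //; apply/eqP; rewrite -all_count.
    apply/allP => x /(nthP 0)[j]; rewrite size_takel // => ji <-.
    rewrite nth_take // inE gt_eqF // (lt_le_trans _ (nth_ge _ _ _ il)) //.
    by rewrite lt_neqAle eq_sym l0 lam0 ?mem_nth.
  exact: leq_addr.
by rewrite cnt leqNgt ltnS -(prednK de0) ide.
Qed.

(** In an eigenbasis of C, tr (QC) is the sum of the eigenvalues weighted by the diagonal entries of
    the conjugated projection, which lie in [0, 1]. Nonzero eigenvalues are at least l, and the D -
    de weights on the kernel add up to at most D - de. *)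
Lemma mxtrace_spectrum_ge C Q lam de : (forall v, 0 <= dotv v (C *m v)) -> C^T = C ->
  spectrum C lam -> (0 < de)%N -> \rank C = de -> orth_proj Q ->
  [/\ 0 < lam`_de.-1, lam`_de.-1 <= lam`_0 &
      lam`_de.-1 * (\tr Q - (D - de)%:R) <= \tr (Q *m C)].
Proof.
move=> psd Cs slam de0 rC [Qs Qi].
have [U [sp [UU CE psp]]] := spectral_decomposition Cs slam.
have Uu := unitarymx_unit UU.
have cnz : #|[pred i | sp 0 i != 0]| = de.
  rewrite -mxrank_diag -rC -(mxrank_map (real_complex R)) -(mxrank_map (real_complex R) C).
  by rewrite CE map_diag_mx mxrankMfree ?row_free_unit // eqmxMfull // row_full_unit unitmx_inv.
have cnt : count (predC1 (0%R : R)) lam = de.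
  by rewrite -(permP psp) count_map -cnz enumT cardE /enum_mem size_filter.
have [l0 l1 lmin] := spectrum_nth_min psd Cs slam de0 cnt.
split => //; set l := lam`_de.-1.
have spl i : sp 0 i != 0 -> l <= sp 0 i.
  by apply: lmin; rewrite -(perm_mem psp) map_f // mem_enum.
pose W (M : 'M[R]_D) := U *m map_mx (real_complex R) M *m invmx U.
(* With M symmetric and idempotent, U M U^-1 = (U M)(U M)^*, whose diagonal entries are sums of
   squared moduli. Applied to 1 - Q, this gives the upper bound 1 as well. *)
have W0 M i : orth_proj M -> 0 <= W M i i.
  move=> [Ms Mi]; rewrite /W invmx_unitary // -Mi map_mxM mulmxA -mulmxA.
  set N := map_mx _ M; have -> : N *m U^t* = (U *m N)^t*.
    rewrite trmx_mul map_mxM /=; congr (_ *m _); apply/matrixP => a b.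
    rewrite !mxE -[in LHS]Ms mxE; apply/esym/CrealP.
    by rewrite complex_real.
  by rewrite mxE sumr_ge0 // => j _; rewrite !mxE mul_conjC_ge0.
have WB i : W Q i i <= 1.
  rewrite -subr_ge0; have := W0 _ i (orth_projC (conj Qs Qi)).
  by rewrite /W map_mxB map_mx1 mulmxBr mulmx1 mulmxBl mulmxV // !mxE eqxx.
have trW : (\tr Q)%:C%C = \sum_i W Q i i.
  by rewrite -[LHS](trace_map_mx (real_complex R)) -[RHS]/(\tr (W Q)) /W -mulmxA mxtrace_mulC mulmxKV.
have trC : (\tr (Q *m C))%:C%C = \sum_i W Q i i * (sp 0 i)%:C%C.
  rewrite -[LHS](trace_map_mx (real_complex R)) map_mxM CE /W !mulmxA mxtrace_mulC !mulmxA.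
  by rewrite /mxtrace; apply: eq_bigr => i _; rewrite mul_mx_diag !mxE.
rewrite -lecR trC rmorphM rmorphB rmorph_nat /= trW.
apply: (@le_trans _ _ (\sum_(i | sp 0 i != 0) W Q i i * l%:C%C)); last first.
  rewrite [leRHS](bigID (fun i => sp 0 i != 0)) /= [X in _ <= _ + X]big1 ?addr0.
    by apply: ler_sum => i /spl li; rewrite ler_wpM2l ?W0 // lecR.
  by move=> i; rewrite negbK => /eqP ->; rewrite mulr0.
rewrite -mulr_suml mulrC; apply: ler_wpM2r; first by rewrite lecR ltW.
rewrite lerBlDr (bigID (fun i => sp 0 i != 0)) /= lerD2l.
have -> : (D - de)%N = #|[pred i | ~~ (sp 0 i != 0)]|.
  by rewrite -[D in LHS]card_ord -(cardC [pred i | sp 0 i != 0]) cnz addKn.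
by rewrite -sum1_card natr_sum ler_sum.
Qed.

End spectrum_bound.

(** * Expectations of bounded random variables *)

Section bounded_measurable.
Context d (T : measurableType d) (R : realType) (P : probability T R).
Implicit Types X Y : T -> R.

(** This class is stable under sums and products and lies in L^1 of a probability, so integrability
    never has to be tracked separately. *)
Definition bdd_measurable X :=
  measurable_fun setT X /\ exists M, forall t, `|X t| <= M.

Lemma bdd_measurable_cst r : bdd_measurable (fun=> r).
Proof. by split; [exact: measurable_cst|exists `|r|]. Qed.

Lemma bdd_measurableD X Y : bdd_measurable X -> bdd_measurable Y ->
  bdd_measurable (fun t => X t + Y t).
Proof.
move=> [mX [M XM]] [mY [N YN]]; split; first exact: measurable_funD.
by exists (M + N) => t; rewrite (le_trans (ler_normD _ _)) // lerD.
Qed.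

Lemma bdd_measurableM X Y : bdd_measurable X -> bdd_measurable Y ->
  bdd_measurable (fun t => X t * Y t).
Proof.
move=> [mX [M XM]] [mY [N YN]]; split; first exact: measurable_funM.
by exists (M * N) => t; rewrite normrM ler_pM.
Qed.

Lemma bdd_measurable_sum (I : Type) (r : seq I) (X : I -> T -> R) :
  (forall i, bdd_measurable (X i)) -> bdd_measurable (fun t => \sum_(i <- r) X i t).
Proof.
move=> bX; elim: r => [|i r IH].
  under eq_fun do rewrite big_nil; exact: bdd_measurable_cst.
under eq_fun do rewrite big_cons; exact: bdd_measurableD.
Qed.

Lemma bdd_measurable_integrable X : bdd_measurable X ->
  P.-integrable setT (EFin \o X).
Proof.
move=> [mX [M XM]]; apply: measurable_bounded_integrable => //.
  by rewrite -ge0_fin_numE // fin_num_measure.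
exists M; split; first exact: num_real.
by move=> y My t _ /=; rewrite (le_trans (XM t)) // ltW.
Qed.

Lemma ExpD X Y : bdd_measurable X -> bdd_measurable Y ->
  \int[P]_w (X w + Y w) = \int[P]_w X w + \int[P]_w Y w.
Proof. by move=> bX bY; rewrite RintegralD //; exact: bdd_measurable_integrable. Qed.

Lemma ExpZ r X : bdd_measurable X -> \int[P]_w (r * X w) = r * \int[P]_w X w.
Proof. by move=> bX; rewrite RintegralZl //; exact: bdd_measurable_integrable. Qed.

Lemma Exp_cst r : \int[P]_w r = r.
Proof.
rewrite Rintegral_cst // (_ : fine _ = 1) ?mulr1 //.
exact: (congr1 fine (probability_setT P)).
Qed.

Lemma Exp_sum (I : Type) (r : seq I) (X : I -> T -> R) :
  (forall i, bdd_measurable (X i)) ->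
  \int[P]_w (\sum_(i <- r) X i w) = \sum_(i <- r) \int[P]_w X i w.
Proof.
move=> bX; elim: r => [|i r IH].
  by under eq_Rintegral do rewrite big_nil; rewrite big_nil Exp_cst.
under eq_Rintegral do rewrite big_cons.
by rewrite ExpD ?big_cons ?IH //; exact: bdd_measurable_sum.
Qed.

Lemma le_Exp X Y : bdd_measurable X -> bdd_measurable Y ->
  (forall w, X w <= Y w) -> \int[P]_w X w <= \int[P]_w Y w.
Proof.
by move=> bX bY XY; apply: le_Rintegral => //; exact: bdd_measurable_integrable.
Qed.

Lemma Exp_EFin X : bdd_measurable X ->
  (\int[P]_w (X w)%:E)%E = (\int[P]_w X w)%:E.
Proof.
move=> bX; rewrite /Rintegral fineK //.
by apply: integrable_fin_num => //; exact: bdd_measurable_integrable.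
Qed.

(** Independence makes the joint law agree with the product of the marginals on rectangles, hence
    everywhere; Tonelli then separates the integral. *)
Lemma ge0_Exp_prod X Y : bdd_measurable X -> bdd_measurable Y ->
  (forall w, 0 <= X w) -> (forall w, 0 <= Y w) ->
  (forall A B, measurable A -> measurable B ->
    P (X @^-1` A `&` Y @^-1` B) = (P (X @^-1` A) * P (Y @^-1` B))%E) ->
  \int[P]_w (X w * Y w) = \int[P]_w X w * \int[P]_w Y w.
Proof.
move=> bX bY X0 Y0 ind; apply: EFin_inj; rewrite EFinM.
rewrite -!Exp_EFin //; last exact: bdd_measurableM.
have [mX _] := bX; have [mY _] := bY.
pose X' : {mfun T >-> R} := HB.pack X (isMeasurableFun.Build _ _ _ _ _ mX).
pose Y' : {mfun T >-> R} := HB.pack Y (isMeasurableFun.Build _ _ _ _ _ mY).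
have mZ : measurable_fun setT (fun w => (X w, Y w)) by exact: measurable_fun_pair.
pose Z' : {mfun T >-> (R * R)%type} := HB.pack (fun w => (X w, Y w)) (isMeasurableFun.Build _ _ _ _ _ mZ).
(* The absolute values make the integrand nonnegative on the whole plane and change nothing on the
   values of X and Y. *)
pose h (z : R * R) : \bar R := (`|z.1| * `|z.2|)%:E.
have mh : measurable_fun setT h.
  apply/measurable_EFinP; apply: measurable_funM.
    by apply: measurableT_comp => //; exact: measurable_fst.
  by apply: measurableT_comp => //; exact: measurable_snd.
have h0 z : (0 <= h z)%E by rewrite lee_fin mulr_ge0.
transitivity (\int[distribution P Z']_z h z)%E.
  rewrite ge0_integral_distribution //; apply: eq_integral => w _ /=.
  by rewrite /h /= !ger0_norm.
transitivity (\int[distribution P X' \x distribution P Y']_z h z)%E.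
  apply: eq_measure_integral => A mA _; apply/esym/product_measure_unique => //.
have mabs : measurable_fun setT (fun x : R => `|x|%:E).
  by apply/measurable_EFinP; exact: normr_measurable.
rewrite fubini_tonelli1 //= /fubini_F.
transitivity (\int[distribution P X']_x (`|x|%:E * (\int[P]_w (Y w)%:E)))%E.
  apply: eq_integral => x _.
  rewrite (_ : (fun y => h (x, y)) = (fun y => `|x|%:E * `|y|%:E)%E); last first.
    by apply/funext => y; rewrite /h /= EFinM.
  rewrite ge0_integralZl //=.
  congr (_ * _)%E; rewrite ge0_integral_distribution //=.
  by apply: eq_integral => w _ /=; rewrite ger0_norm.
rewrite ge0_integralZr //=; last first.
  by apply: integral_ge0 => w _; rewrite lee_fin.
congr (_ * _)%E; rewrite ge0_integral_distribution //=.
by apply: eq_integral => w _ /=; rewrite ger0_norm.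
Qed.

Lemma Exp_prod X Y : bdd_measurable X -> bdd_measurable Y ->
  (forall A B, measurable A -> measurable B ->
    P (X @^-1` A `&` Y @^-1` B) = (P (X @^-1` A) * P (Y @^-1` B))%E) ->
  \int[P]_w (X w * Y w) = \int[P]_w X w * \int[P]_w Y w.
Proof.
(* Adding the bounds M and N reduces to nonnegative variables. *)
move=> bX bY ind; have [mX [M XM]] := bX; have [mY [N YN]] := bY.
have bXM : bdd_measurable (fun w => X w + M).
  by apply: bdd_measurableD bX _; exact: bdd_measurable_cst.
have bYN : bdd_measurable (fun w => Y w + N).
  by apply: bdd_measurableD bY _; exact: bdd_measurable_cst.
have := ge0_Exp_prod bXM bYN.
have -> : (fun w => (X w + M) * (Y w + N)) =
    (fun w => X w * Y w + (N * X w + (M * Y w + M * N))).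
  by apply/funext => w; ring.
have bc r : bdd_measurable (fun _ : T => r) by exact: bdd_measurable_cst.
have bZ r Z : bdd_measurable Z -> bdd_measurable (fun w => r * Z w).
  by apply: bdd_measurableM; exact: bc.
have bXY := bdd_measurableM bX bY.
have b1 := bdd_measurableD (bZ M _ bY) (bc (M * N)).
have b2 := bdd_measurableD (bZ N _ bX) b1.
rewrite (ExpD bXY b2) (ExpD (bZ N _ bX) b1) (ExpD (bZ M _ bY) (bc _)).
rewrite (ExpD bX (bc M)) (ExpD bY (bc N)) !ExpZ // !Exp_cst.
move=> H; suff : \int[P]_w (X w * Y w) +
     (N * \int[P]_w X w + (M * \int[P]_w Y w + M * N)) =
     (\int[P]_w X w + M) * (\int[P]_w Y w + N) by move=> ?; lra.
apply: H.
- by move=> w; have := XM w; rewrite ler_norml => /andP[? _]; lra.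
- by move=> w; have := YN w; rewrite ler_norml => /andP[? _]; lra.
move=> A B mA mB.
(* Independence of X + M and Y + N is that of X and Y on translated sets. *)
pose sh r (A : set R) := (fun x => x + r) @^-1` A.
have msh r (C : set R) : measurable C -> measurable (sh r C).
  by move=> mC; rewrite -[sh _ _]setTI; apply: measurable_funD.
exact: (ind (sh M A) (sh N B)) (msh _ _ mA) (msh _ _ mB).
Qed.

End bounded_measurable.

(** * Grouping of independent families and densities *)

Section independence.
Context d (Omega : measurableType d) (R : realType) (P : probability Omega R).

(** A pi-system argument: intersections of events indexed by subsets of A generate the joint
    sigma-algebra, and on them the product formula is the joint independence of the family. *)
Lemma independent_family_grouping (I : finType) (G : I -> set_system Omega)
    (A : {set I}) (i : I) :
  (forall j, sigma_algebra setT (G j)) -> (forall j, G j `<=` measurable) ->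
  independent_family P G -> i \notin A ->
  independent2 P <<s \bigcup_(j in [set` A]) G j >> (G i).
Proof.
move=> sG mG indG iA E F.
pose PI : set_system Omega := [set B | exists J : {set I}, exists H : I -> set Omega,
  [/\ J \subset A, forall j, j \in J -> G j (H j) & B = \bigcap_(j in [set` J]) H j]].
have GT j : G j setT by have [G0 GD _] := sG j; rewrite -(setD0 setT); exact: GD.
have GI j : setI_closed (G j).
  rewrite -(sigma_algebra_id (sG j)) => B C GB GC.
  exact: (@measurableI _ (g_sigma_algebraType (G j))).
move=> pE GF; have mF := mG _ _ GF.
have mPI : PI `<=` measurable.
  move=> _ [J [H [_ GH ->]]]; apply: fin_bigcap_measurable; first exact: finite_finset.
  by move=> j jJ; apply: (mG j); exact: GH.
have PIT : PI setT.
  exists finset.set0, (fun=> setT); split; [exact: finset.sub0set|by move=> j; rewrite inE|].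
  by apply/seteqP; split=> // w _ j; rewrite /= inE.
have PII : setI_closed PI.
  move=> _ _ [J [H [JA GH ->]]] [J' [H' [JA' GH' ->]]].
  exists (J :|: J'), (fun j => (if j \in J then H j else setT) `&`
                            (if j \in J' then H' j else setT)); split.
  - by rewrite finset.subUset JA JA'.
  - by move=> j _; apply: GI; case: ifP => // jJ; [exact: GH|exact: GH'].
  apply/seteqP; split => w.
    by move=> [h h'] j _; split; case: ifP => // jJ; [exact: h|exact: h'].
  move=> h; split=> j jJ; have := h j; rewrite /= finset.in_setU jJ ?orbT => /(_ isT)[] //.
have r0 : 0 <= fine (P F) by exact: fine_ge0.
have PFE : (fine (P F))%:E = P F by rewrite fineK // fin_num_measure.
have cov : \bigcup_(k in [set: nat]) [set: Omega] = setT.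
  by rewrite bigcup_const //; exists 0%N.
(* The finite measures compared are E -> P (E [&] F) and E -> P F * P E. *)
have uniq := @g_sigma_algebra_measure_unique _ _ _ PI mPI (fun=> setT) (fun=> PIT) cov
  (mrestr P mF) (mscale (NngNum r0) P) PII.
have -> : P (E `&` F) = mrestr P mF E by [].
rewrite uniq.
- by rewrite muleC; congr (_ * _)%E; exact: PFE.
- move=> _ [J [H [JA GH ->]]]; transitivity (P F * P (\bigcap_(j in [set` J]) H j))%E; last first.
    by congr (_ * _)%E; exact/esym/PFE.
  rewrite [LHS](_ : _ = P (\bigcap_(j in [set` J]) H j `&` F)) //.
  have iJ : i \notin J by apply: contra iA; exact: (fintype.subsetP JA).
  (* Inserting F at the index i, which is outside J, expresses the event as an intersection over
     [i |: J], from which P F factors out. *)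
  pose H' j := if j == i then F else H j.
  have H'J j : j \in J -> H' j = H j.
    by move=> jJ; rewrite /H'; case: eqP => // ji; rewrite -ji jJ in iJ.
  have GH' j : j \in i |: J -> G j (H' j).
    by rewrite !inE /H'; case: eqP => [->|_ /= /GH].
  have -> : \bigcap_(j in [set` J]) H j `&` F = \bigcap_(j in [set` i |: J]) H' j.
    apply/seteqP; split => w.
      move=> [h Fw] j /=; rewrite !inE /H'; case: eqP => [->//|_ /= jJ]; exact: h.
    move=> h; split; last by have := h i; rewrite /H' eqxx; apply; rewrite /= !inE eqxx.
    by move=> j jJ; rewrite -H'J //; apply: h; rewrite /= !inE jJ orbT.
  rewrite indG // big_setU1 //= {1}/H' eqxx; congr (_ * _)%E.
  rewrite indG //; apply: eq_bigr => j jJ; rewrite H'J //.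
- by move=> _; rewrite -ge0_fin_numE // fin_num_measure.
- apply: sub_sigma_algebra2 pE => B [j jA GB].
  exists [set j]%SET, (fun=> B); split; first by rewrite finset.sub1set.
    by move=> l; rewrite inE => /eqP ->.
  apply/seteqP; split => w; first by move=> Bw l.
  by move=> /(_ j); apply; rewrite /= inE.
Qed.

End independence.

Section density.
Context d (Omega : measurableType d) (R : realType) (P : probability Omega R).
Variable D : nat.

(** The law of X is dominated by Lebesgue measure and its Radon-Nikodym derivative agrees almost
    everywhere with rho, both having the same integrals over measurable sets. *)
Lemma Exp_density (X : {RV P >-> 'cV[R]_D}) (rho h : 'cV[R]_D -> R) :
  prob_density rho -> has_density X rho -> bdd_measurable h ->
  \int[P]_w h (X w) = \int[lebesgue_cV D]_x (h x * rho x).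
Proof.
move=> [mrho rho0 rho1] Xrho bh; have [mh [M hM]] := bh.
have bhX : bdd_measurable (h \o X).
  by split; [exact: measurableT_comp|exists M => w; exact: hM].
have irho : (lebesgue_cV D).-integrable setT (EFin \o rho).
  apply/integrableP; split; first exact/measurable_EFinP.
  under eq_integral do rewrite /= ger0_norm //.
  by rewrite rho1 ltry.
have dom : distribution P X `<< lebesgue_cV D.
  apply/null_content_dominatesP => A mA A0; rewrite Xrho //.
  by apply: null_set_integral => //; apply/measurable_EFinP; exact: measurable_funTS.
rewrite /Rintegral; congr fine.
transitivity (\int[distribution P X]_x (h x)%:E)%E.
  rewrite integral_distribution //; first exact/measurable_EFinP.
  exact: bdd_measurable_integrable.
rewrite -(Radon_Nikodym_change_of_variables dom) //=; last first.
  exact: bdd_measurable_integrable.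
under [RHS]eq_integral do rewrite EFinM.
apply: ae_eq_integral => //.
- apply: emeasurable_funM; first exact/measurable_EFinP.
  apply: (measurable_int (lebesgue_cV D)).
  exact: Radon_Nikodym_integrable.
- by apply: emeasurable_funM; exact/measurable_EFinP.
apply: ae_eqe_mul2l; rewrite Radon_NikodymE //=.
case: cid => /= g [g1 g2 g3].
apply: integral_ae_eq => //=; first exact/measurable_EFinP.
by move=> E _ mE; rewrite -g3 // -Xrho.
Qed.

End density.

(** * Gradients and effective dimension *)

Section gradient.
Context {R : realType} {D : nat}.
Implicit Types (f : 'cV[R]_D -> R) (u v x : 'cV[R]_D).

Lemma derive_grad f x v : differentiable f x -> 'D_v f x = dotv (grad f x) v.
Proof.
move=> df; rewrite deriveE // [X in 'd f x X](_ : v = \sum_i v i 0 *: delta_mx i 0); last first.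
  rewrite {1}[v]matrix_sum_delta; apply: eq_bigr => i _.
  by rewrite big_ord1.
rewrite linear_sum /=; apply: eq_bigr => i _.
by rewrite linearZ /= mxE deriveE // mulrC.
Qed.

Lemma is_derive_line f x v (t : R) : differentiable f (x + t *: v) ->
  is_derive t 1 (fun r => f (x + r *: v)) (dotv (grad f (x + t *: v)) v).
Proof.
move=> df; rewrite -derive_grad //.
have dv : derivable f (x + t *: v) v by exact: diff_derivable.
have E : (fun h => h^-1 *: (((fun r => f (x + r *: v)) \o shift t) (h *: 1) -
                           f (x + t *: v))) =
    (fun h => h^-1 *: ((f \o shift (x + t *: v)) (h *: v) - f (x + t *: v))).
  apply/funext => h /=; congr (_ *: (f _ - _)).
  by rewrite [h *: 1]mulr1 scalerDl addrCA.
by apply: DeriveDef; rewrite /derivable /derive /= E.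
Qed.

(** Along the line through x in direction v the derivative of f vanishes identically, so f is
    constant there. *)
Lemma invariant_of_grad_orth f v : (forall x, differentiable f x) ->
  (forall x, dotv (grad f x) v = 0) -> forall x, f (x + v) = f x.
Proof.
move=> df gv x.
have h (t : R) : is_derive t 1 (fun r : R => f (x + r *: v)) 0.
  by rewrite -(gv (x + t *: v)); exact: is_derive_line.
have := @is_derive_0_is_cst _ (fun r : R => f (x + r *: v)) 1 0 h.
by rewrite scale1r scale0r addr0.
Qed.

Lemma grad_orth_of_invariant f v : (forall x, differentiable f x) ->
  (forall x t, f (x + t *: v) = f x) -> forall x, dotv (grad f x) v = 0.
Proof.
move=> df fv x; have := @is_derive_line f x v 0 (df _); rewrite scale0r addr0.
under eq_fun do rewrite fv.
by move=> [_ <-]; rewrite derive_cst.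
Qed.

End gradient.

(** The columns of [cokermx B] are killed by B, so they are killed by A, which is the criterion for
    inclusion of row spaces. *)
Lemma submx_of_ker (F : fieldType) m n p (A : 'M[F]_(m, p)) (B : 'M[F]_(n, p)) :
  (forall v : 'cV_p, B *m v = 0 -> A *m v = 0) -> (A <= B)%MS.
Proof.
move=> BA; rewrite submxE; apply/eqP/matrixP => i j.
have /colP/(_ i) : A *m col j (cokermx B) = 0.
  by apply: BA; rewrite colE mulmxA mulmx_coker mul0mx.
by rewrite colE mulmxA -colE !mxE.
Qed.

Section effective_dimension.
Context {R : realType} {D : nat}.
Implicit Types (f : 'cV[R]_D -> R) (u v x : 'cV[R]_D) (T : {vspace 'cV[R]_D}).

Lemma dotvC u v : dotv u v = dotv v u.
Proof. by apply: eq_bigr => i _; rewrite mulrC. Qed.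

Lemma dotvDr u v x : dotv u (v + x) = dotv u v + dotv u x.
Proof. by rewrite /dotv -big_split; apply: eq_bigr => i _; rewrite mxE mulrDr. Qed.

Lemma dotvZr a u v : dotv u (a *: v) = a * dotv u v.
Proof. by rewrite /dotv mulr_sumr; apply: eq_bigr => i _; rewrite mxE mulrCA. Qed.

Lemma dotv_sumr I (r : seq I) u (F : I -> 'cV[R]_D) :
  dotv u (\sum_(i <- r) F i) = \sum_(i <- r) dotv u (F i).
Proof.
elim: r => [|i r IH]; last by rewrite !big_cons dotvDr IH.
by rewrite !big_nil /dotv big1 // => i _; rewrite mxE mulr0.
Qed.

Lemma orthogonal_complement_basis T v :
  (forall i, dotv (vbasis T)`_i v = 0) -> orthogonal_complement T v.
Proof.
move=> Tv u uT; rewrite (coord_vbasis uT) dotvC dotv_sumr big1 // => i _.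
by rewrite dotvZr dotvC Tv mulr0.
Qed.

(** Deflating by a basis of T gives a projection Q that kills T; then Qx is orthogonal to T, and x -
    Qx lies in T. *)
Lemma orthogonal_decomposition T x :
  exists2 u, u \in T & orthogonal_complement T (x - u).
Proof.
pose Q := deflation (fun i => (vbasis T)`_i).
(* Each deflation step adds to this difference a multiple of the projected basis vector, which
   itself differs from the basis vector by an element of T. *)
have QT k y : y - Q k *m y \in T.
  elim: k y => [|k IH] y; first by rewrite mul1mx subrr mem0v.
  rewrite /Q /= -/(Q k) /deflate mulmxBl opprD opprK addrA.
  apply: memvD; first exact: IH.
  set h := Q k *m _; have hT : h \in T.
    rewrite -[h](subKr (vbasis T)`_k) memvB ?IH //.
    have [kT|Tk] := ltnP k (\dim T); last by rewrite nth_default ?size_tuple ?mem0v.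
    by rewrite vbasis_mem // mem_nth ?size_tuple.
  rewrite -scalemxAl -mulmxA [h^T *m y]mx11_scalar mul_mx_scalar.
  by rewrite !memvZ.
exists (x - Q (\dim T) *m x) => //; rewrite opprB addrC subrK.
apply: orthogonal_complement_basis => i.
have [iT|Ti] := ltnP i (\dim T); last first.
  rewrite nth_default ?size_tuple // dotvE trmx0 mul0mx mxE //.
have Qs : (Q (\dim T))^T = Q (\dim T) by exact: (orth_proj_deflation _ _).1.
have QK : Q (\dim T) *m (vbasis T)`_i = 0.
  exact: (deflation_ker (fun i => (vbasis T)`_i) iT).
by rewrite dotvE mulmxA -Qs -trmx_mul QK trmx0 mul0mx mxE.
Qed.

(** Upper bound: f is invariant along the complement of T, so C kills it and the rows of C lie in T.
    Lower bound: f depends only on the component in the row space of C, and [de] is minimal. *)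
Lemma mxrank_effective_dim f (C : 'M[R]_D) de :
  (forall x, differentiable f x) -> C^T = C ->
  (forall v, C *m v = 0 <-> forall x, dotv (grad f x) v = 0) ->
  effective_dim f de -> \rank C = de.
Proof.
move=> df Cs Cker [[T [dT fT]] demin]; apply/eqP; rewrite eqn_leq; apply/andP; split.
  (* The definition gives invariance only at base points in T; writing x = u + (x - u) with u in T
     puts both x - u and x - u + v in the complement. *)
  have fTi x v : orthogonal_complement T v -> f (x + v) = f x.
    have [u uT xu] := orthogonal_decomposition T x.
    move=> vT; rewrite -[x in LHS](subrK u) -[x in RHS](subrK u).
    rewrite -addrA addrC -addrA [_ + u]addrC !fT // => w wT.
    by rewrite dotvDr vT // xu // addr0.
  pose B : 'M[R]_(\dim T, D) := \matrix_(i, j) (vbasis T)`_i j 0.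
  suff : (C <= B)%MS by move=> /mxrankS/leq_trans; apply; rewrite -dT rank_leq_row.
  apply: submx_of_ker => v Bv; apply/Cker.
  have vT : orthogonal_complement T v.
    apply: orthogonal_complement_basis => i.
    have [iT|Ti] := ltnP i (\dim T); last first.
      by rewrite nth_default ?size_tuple // dotvE trmx0 mul0mx mxE.
    have /colP/(_ (Ordinal iT)) := Bv; rewrite !mxE => <-.
    by apply: eq_bigr => j _; rewrite mxE.
  apply: grad_orth_of_invariant => // x t; apply: fTi => u uT.
  by rewrite dotvZr vT // mulr0.
apply: demin.
(* The witness is the span of a row basis of C; vectors orthogonal to it are exactly those killed by
   C. *)
pose X : (\rank C).-tuple 'cV[R]_D := [tuple (row i (row_base C))^T | i < \rank C].
have XE (i : 'I_(\rank C)) : X`_i = (row i (row_base C))^T by rewrite -tnth_nth tnth_mktuple.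
have frX : free X.
  apply/freeP => k kX i.
  have : (\row_i k i) *m row_base C = 0.
    rewrite mulmx_sum_row; apply: trmx_inj; rewrite trmx0 -kX linear_sum.
    by apply: eq_bigr => j _; rewrite /= linearZ /= XE mxE.
  move=> /eqP; rewrite mulmx_free_eq0 ?row_base_free // => /eqP/rowP/(_ i).
  by rewrite !mxE.
exists <<X>>%VS; split; first by move: frX; rewrite /free => /eqP ->; rewrite size_tuple.
move=> x v _ vX; apply: invariant_of_grad_orth => //; apply/Cker.
have : row_base C *m v = 0.
  apply/row_matrixP => i; rewrite row_mul row0; apply/rowP => j; rewrite ord1.
  rewrite -[row i _]trmxK -dotvE mxE; apply: vX; rewrite -XE.
  by apply: memv_span; rewrite mem_nth // size_tuple.
move=> rv; have /submxP[B CB] : (C <= row_base C)%MS by rewrite eq_row_base.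
by have /(congr1 (mulmx^~ v)) := CB; rewrite -mulmxA rv mulmx0.
Qed.

End effective_dimension.

(** * Measurability of matrix-valued functions *)

Section measurable_matrices.
Context {R : realType}.

Lemma continuous_measurable_mx m n (h : 'M[R]_(m, n) -> R) :
  continuous h -> measurable_fun setT h.
Proof.
move=> ch; apply: (measurability _ (RGenOpens.measurableE R)) => _ [_ [a [b ->]] <-].
by rewrite setTI; apply: measurable_mx_open; exact: open_comp (interval_open _ _).
Qed.

Lemma measurable_fun_sum_fin d (T : measurableType d) (I : Type) (r : seq I)
    (h : I -> T -> R) : (forall i, measurable_fun setT (h i)) ->
  measurable_fun setT (fun t => \sum_(i <- r) h i t).
Proof.
move=> mh; elim: r => [|i r IH].
  under eq_fun do rewrite big_nil; exact: measurable_cst.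
under eq_fun do rewrite big_cons; exact: measurable_funD.
Qed.

Lemma measurable_mulmx d (T : measurableType d) m n p (A : T -> 'M[R]_(m, n))
    (B : T -> 'M[R]_(n, p)) i j :
  (forall i j, measurable_fun setT (fun t => A t i j)) ->
  (forall i j, measurable_fun setT (fun t => B t i j)) ->
  measurable_fun setT (fun t => (A t *m B t) i j).
Proof.
move=> mA mB; under eq_fun do rewrite mxE.
by apply: measurable_fun_sum_fin => l; exact: measurable_funM.
Qed.

Lemma measurable_deflation d (T : measurableType d) D (vs : nat -> T -> 'cV[R]_D) k :
  (forall i j, (i < k)%N -> measurable_fun setT (fun t => vs i t j 0)) ->
  forall i j, measurable_fun setT (fun t => deflation (vs^~ t) k i j).
Proof.
elim: k => [|k IH] mv i j /=; first exact: measurable_cst.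
have mQ a b : measurable_fun setT (fun t => deflation (vs^~ t) k a b).
  by apply: IH => c e ck; apply: mv; rewrite ltnW.
pose h t := deflation (vs^~ t) k *m vs k t.
have mh a b : measurable_fun setT (fun t => h t a b).
  by apply: measurable_mulmx => // c e; rewrite ord1; exact: mv.
(* The inverse is written as a real power, a measurable function; the two agree on nonnegative
   numbers, including the value 0 at 0. *)
rewrite (_ : (fun t => _) = (fun t => deflation (vs^~ t) k i j -
    (dotv (h t) (h t)) `^ (-1) * (h t i 0 * h t j 0))); last first.
  apply/funext => t; rewrite powR_inv1 ?dotvv_ge0 // /deflate -/(h t).
  by rewrite !mxE big_ord1 !mxE.
apply: measurable_funB => //; apply: measurable_funM; last exact: measurable_funM.
apply: (@measurableT_comp _ _ _ _ _ _ (fun x : R => x `^ (-1))).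
  exact: measurable_powR.
by apply: measurable_fun_sum_fin => l; exact: measurable_funM.
Qed.

Lemma continuous_sumr (T : topologicalType) I (r : seq I) (h : I -> T -> R) :
  (forall i, continuous (h i)) -> continuous (fun x => \sum_(i <- r) h i x).
Proof.
move=> ch; elim: r => [|i r IH] x.
  by under eq_fun do rewrite big_nil; exact: cst_continuous.
by under eq_fun do rewrite big_cons; apply: cvgD; [exact: ch|exact: IH].
Qed.

Lemma continuous_prodr (T : topologicalType) I (r : seq I) (h : I -> T -> R) :
  (forall i, continuous (h i)) -> continuous (fun x => \prod_(i <- r) h i x).
Proof.
move=> ch; elim: r => [|i r IH] x.
  by under eq_fun do rewrite big_nil; exact: cst_continuous.
by under eq_fun do rewrite big_cons; apply: cvgM; [exact: ch|exact: IH].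
Qed.

(** Rank at least r means that some compression B M E of size r is invertible, and the determinant
    of each compression is continuous in M. *)
Lemma open_mxrank_ge m n r : open [set M : 'M[R]_(m, n) | (r <= \rank M)%N].
Proof.
rewrite (_ : [set _ | _] = \bigcup_(p in [set: 'M[R]_(r, m) * 'M[R]_(n, r)])
    [set M | \det (p.1 *m M *m p.2) != 0]).
  apply: bigcup_open => -[B E] _ /=.
  have cst_mul (c : R) (h : 'M[R]_(m, n) -> R) : continuous h -> continuous (fun M => c * h M).
    move=> ch M; apply: (@continuousM _ _ (fun=> c) h M); [exact: cst_continuous|exact: ch].
  have cdet : continuous (fun M : 'M[R]_(m, n) => \det (B *m M *m E)).
    rewrite /determinant; apply: continuous_sumr => s; apply: (cst_mul).
    apply: continuous_prodr => i; under eq_fun do rewrite mxE.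
    apply: continuous_sumr => j; under eq_fun do rewrite mulrC.
    apply: (cst_mul); under eq_fun do rewrite mxE.
    apply: continuous_sumr => l; apply: (cst_mul).
    exact: coord_continuous.
  apply: (@open_comp _ _ (fun M => \det (B *m M *m E)) [set x | x != 0]).
    by move=> M _; exact: cdet.
  exact: open_neq.
apply/seteqP; split => [M /= rM|M [[B E] _ /= BE]].
  (* Undoing the rank normal form of M and truncating to size r leaves the identity. *)
  exists (pid_mx r *m invmx (col_ebase M), invmx (row_ebase M) *m pid_mx r) => //=.
  have -> : pid_mx r *m invmx (col_ebase M) *m M *m (invmx (row_ebase M) *m pid_mx r) =
      pid_mx r *m (invmx (col_ebase M) *m M *m invmx (row_ebase M)) *m pid_mx r.
    by move=> ? ?; rewrite !mulmxA.
  rewrite -{2}(mulmx_ebase M) !mulmxA mulmxK ?row_ebase_unit //.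
  rewrite -(mulmxA (pid_mx r) (invmx _)) mulVmx ?col_ebase_unit // mulmx1.
  rewrite !mul_pid_mx.
  have rm : (r <= m)%N := leq_trans rM (rank_leq_row M).
  have rn : (r <= n)%N := leq_trans rM (rank_leq_col M).
  rewrite (minn_idPl rM) (minn_idPr rm) minnn (minn_idPr rn).
  by rewrite pid_mx_1 det1 oner_eq0.
have : \rank (B *m M *m E) = r by apply: mxrank_unit; rewrite unitmxE unitfE.
move=> <-; apply: leq_trans (mxrankM_maxl _ _) _; exact: mxrankM_maxr.
Qed.

Lemma measurable_mxrank_ge d (T : measurableType d) m n (A : T -> 'M[R]_(m, n)) r :
  (forall i j, measurable_fun setT (fun t => A t i j)) ->
  measurable [set t | (r <= \rank (A t))%N].
Proof.
move=> mA; have mf := measurable_fun_mx mA.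
have := mf measurableT _ (measurable_mx_open (@open_mxrank_ge m n r)).
by rewrite setTI.
Qed.

End measurable_matrices.

(** * The covariance of the gradients *)

Section sampled_gradients.
Context d (Omega : measurableType d) (R : realType) (P : probability Omega R).
Variables (D : nat) (f rho : 'cV[R]_D -> R) (L : R).
Hypotheses (fC1 : C1 f) (L0 : 0 < L) (gradL : forall x, enorm (grad f x) <= L).
Hypothesis rho_density : prob_density rho.
Implicit Types X : {RV P >-> 'cV[R]_D}.

Local Notation C := (grad_cov f rho).

Lemma bdd_measurable_grad a : bdd_measurable (fun x => grad f x a 0).
Proof.
split.
  apply: continuous_measurable_mx => x.
  exact: (continuous_comp (fC1.2 x) (@coord_continuous R D 1 a 0 _)).
exists L => x; apply: le_trans (gradL x).
rewrite -(@ler_pXn2r _ 2%N) ?nnegrE ?sqrtr_ge0 // real_normK ?num_real //.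
by rewrite sqr_sqrtr ?dotvv_ge0 // dotv_sq_le_norm.
Qed.

Lemma bdd_measurable_comp X (h : 'cV[R]_D -> R) :
  bdd_measurable h -> bdd_measurable (h \o X).
Proof.
by move=> [mh [M hM]]; split; [exact: measurableT_comp|exists M => w; exact: hM].
Qed.

Lemma Exp_grad_grad X a b : has_density X rho ->
  \int[P]_w (grad f (X w) a 0 * grad f (X w) b 0) = C a b.
Proof.
move=> Xrho; rewrite mxE.
rewrite (Exp_density rho_density Xrho (h := fun x => grad f x a 0 * grad f x b 0)).
  apply: eq_Rintegral => x _; congr (_ * _).
  by rewrite [RHS]mxE big_ord1; congr (_ * _); rewrite [RHS]mxE.
by apply: bdd_measurableM; exact: bdd_measurable_grad.
Qed.

Lemma grad_cov_sym X : has_density X rho -> C^T = C.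
Proof.
move=> Xrho; apply/matrixP => a b; rewrite mxE -!(Exp_grad_grad _ _ Xrho).
by apply: eq_Rintegral => w _; rewrite mulrC.
Qed.

Lemma dotv_mulmx (g : 'cV[R]_D) (Q : 'M[R]_D) :
  dotv g (Q *m g) = \sum_a \sum_b Q a b * (g a 0 * g b 0).
Proof.
rewrite /dotv; apply: eq_bigr => a _; rewrite mxE mulr_sumr.
by apply: eq_bigr => b _; rewrite mulrCA.
Qed.

(** The form expands into products of an entry of Q and an entry of the outer product of the
    gradient; these are independent, and the latter has mean the matching entry of C. *)
Lemma Exp_quadratic X (Q : Omega -> 'M[R]_D) : has_density X rho ->
  (forall a b, bdd_measurable (fun w => Q w a b)) ->
  (forall a b (A B : set R) (h : 'cV[R]_D -> R), measurable_fun setT h ->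
    measurable A -> measurable B ->
    P ((fun w => Q w a b) @^-1` A `&` (h \o X) @^-1` B) =
      (P ((fun w => Q w a b) @^-1` A) * P ((h \o X) @^-1` B))%E) ->
  \int[P]_w dotv (grad f (X w)) (Q w *m grad f (X w)) = \int[P]_w \tr (Q w *m C).
Proof.
move=> Xrho bQ indQ.
have bgg a b : bdd_measurable (fun x => grad f x a 0 * grad f x b 0).
  by apply: bdd_measurableM; exact: bdd_measurable_grad.
have bggX a b := bdd_measurable_comp X (bgg a b).
under eq_Rintegral do rewrite dotv_mulmx.
have bt a b : bdd_measurable (fun w => Q w a b * (grad f (X w) a 0 * grad f (X w) b 0)).
  by apply: bdd_measurableM => //; exact: bggX.
have bc a b : bdd_measurable (fun w => Q w a b * C b a).
  by apply: bdd_measurableM => //; exact: bdd_measurable_cst.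
rewrite Exp_sum; last by move=> a; apply: bdd_measurable_sum.
rewrite [in RHS](_ : (fun w => \tr (Q w *m C)) = (fun w => \sum_a \sum_b Q w a b * C b a)); last first.
  by apply/funext => w; apply: eq_bigr => a _; rewrite mxE.
rewrite Exp_sum; last by move=> a; apply: bdd_measurable_sum.
apply: eq_bigr => a _; rewrite !Exp_sum //; apply: eq_bigr => b _.
rewrite Exp_prod //; last first.
- by move=> A B mA mB; apply: (indQ a b A B _ (bgg a b).1).
- exact: bggX.
rewrite Exp_grad_grad //; have -> : C a b = C b a.
  by have /matrixP/(_ b a) := grad_cov_sym Xrho; rewrite mxE.
by rewrite mulrC -ExpZ //; apply: eq_Rintegral => w _; rewrite mulrC.
Qed.

Lemma Exp_grad_sq X v : has_density X rho ->
  \int[P]_w (dotv (grad f (X w)) v) ^+ 2 = dotv v (C *m v).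
Proof.
move=> Xrho; transitivity (\int[P]_w dotv (grad f (X w)) (v *m v^T *m grad f (X w))).
  apply: eq_Rintegral => w _; rewrite -mulmxA [v^T *m _]mx11_scalar mul_mx_scalar.
  by rewrite dotvZr -dotvE [dotv v _]dotvC expr2.
rewrite (Exp_quadratic (Q := fun=> v *m v^T) Xrho) ?Exp_cst.
- by rewrite -mulmxA mxtrace_mulC dotvE -mulmxA [LHS]big_ord1.
- by move=> a b; exact: bdd_measurable_cst.
move=> a b A B h mh mA mB; rewrite preimage_cst; case: ifPn => _.
  by rewrite setTI probability_setT mul1e.
by rewrite set0I measure0 mul0e.
Qed.

Lemma grad_cov_psd X v : has_density X rho -> 0 <= dotv v (C *m v).
Proof.
by move=> Xrho; rewrite -(Exp_grad_sq v Xrho); apply: Rintegral_ge0 => w _; exact: sqr_ge0.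
Qed.

(** If Cv = 0, the squared slope along v has mean v . Cv = 0; being continuous and nonnegative, it
    vanishes everywhere because the density charges every nonempty open set. *)
Lemma grad_cov_ker X v : has_density X rho -> full_support rho ->
  C *m v = 0 <-> forall x, dotv (grad f x) v = 0.
Proof.
move=> Xrho supp; split => [Cv x0|gv]; last first.
  have bgg a b : bdd_measurable (fun w => grad f (X w) a 0 * grad f (X w) b 0).
    by apply: (bdd_measurable_comp X (h := fun x => grad f x a 0 * grad f x b 0));
      apply: bdd_measurableM; exact: bdd_measurable_grad.
  apply/colP => a; rewrite [RHS]mxE [LHS]mxE.
  transitivity (\sum_b \int[P]_w (v b 0 * (grad f (X w) a 0 * grad f (X w) b 0))).
    by apply: eq_bigr => b _; rewrite ExpZ // Exp_grad_grad // mulrC.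
  rewrite -Exp_sum => [|b]; last first.
    by apply: bdd_measurableM; [exact: bdd_measurable_cst|exact: bgg].
  rewrite -[RHS](Exp_cst P); apply: eq_Rintegral => w _.
  transitivity (grad f (X w) a 0 * dotv (grad f (X w)) v); last by rewrite gv mulr0.
  by rewrite /dotv mulr_sumr; apply: eq_bigr => b _; rewrite mulrCA [v b 0 * _]mulrC mulrA.
apply/eqP; apply/negPn/negP => g0.
(* Half the value at x0 is exceeded on an open set around x0. *)
pose h x := (dotv (grad f x) v) ^+ 2; pose c := h x0 / 2.
have h0 : 0 < h x0 by rewrite /h exprn_even_gt0.
have c0 : 0 < c by rewrite divr_gt0.
have hc : continuous h.
  have dc : continuous (fun x => dotv (grad f x) v).
    apply: continuous_sumr => i x.
    apply: (@continuousM _ _ (fun x => grad f x i 0) (fun=> v i 0)).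
      exact: (continuous_comp (fC1.2 x) (@coord_continuous R D 1 i 0 _)).
    exact: cst_continuous.
  by move=> x; apply: (@continuousM _ _ _ _ x (dc x) (dc x)).
pose U := h @^-1` [set y | c < y].
have oU : open U by apply: open_comp => [x _|]; [exact: hc|exact: open_gt].
have U0 : U !=set0 by exists x0; rewrite /U /= /c ltr_pdivrMr // ltr_pMr // ltr1n.
have mU : measurable U by exact: measurable_mx_open.
have mXU : measurable (X @^-1` U).
  by rewrite -[_ @^-1` _]setTI; exact: (measurable_funP X).
have := supp U oU U0; rewrite -Xrho // => PU.
have bh : bdd_measurable h.
  have bd : bdd_measurable (fun x => dotv (grad f x) v).
    apply: bdd_measurable_sum => i; apply: bdd_measurableM.
      exact: bdd_measurable_grad.
    exact: bdd_measurable_cst.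
  exact: (bdd_measurableM bd bd).
have b1 : bdd_measurable (fun w => c * \1_(X @^-1` U) w).
  apply: bdd_measurableM; first exact: bdd_measurable_cst.
  split; first exact: measurable_indic.
  by exists 1 => w; rewrite indicE; case: (_ \in _); rewrite ?normr1 ?normr0.
(* The integral of this minorant is c P(X in U) > 0, contradicting the zero mean of h(X). *)
have : \int[P]_w (c * \1_(X @^-1` U) w) <= \int[P]_w h (X w).
  apply: le_Exp => // [|w]; first exact: (bdd_measurable_comp X bh).
  rewrite indicE; case: (boolP (_ \in _)) => [|_]; last by rewrite mulr0 sqr_ge0.
  by rewrite inE mulr1 => /ltW.
rewrite Exp_grad_sq // Cv /dotv big1 => [|i _]; last by rewrite mxE mulr0.
apply/negP; rewrite -ltNge -lte_fin -Exp_EFin //.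
under eq_integral do rewrite EFinM.
rewrite ge0_integralZl //=; last 2 first.
  by apply/measurable_EFinP; exact: measurable_indic.
  by rewrite lee_fin ltW.
by rewrite integral_indic // setIT mule_gt0.
Qed.

End sampled_gradients.

(** * Rank deficiency of the sampled covariance *)

Section generated_sigma_algebras.
Context d (Omega : measurableType d) (R : realType) (P : probability Omega R).

Lemma sigma_gen_preimage m n (X : Omega -> 'M[R]_(m, n)) (h : 'M[R]_(m, n) -> R) B :
  measurable_fun setT h -> measurable B -> sigma_gen X ((h \o X) @^-1` B).
Proof.
move=> mh mB; rewrite /sigma_gen g_sigma_preimageE.
exists (h @^-1` B); last by rewrite setTI.
by have := mh measurableT _ mB; rewrite setTI.
Qed.

Lemma sigma_gen_measurable m n (X : {RV P >-> 'M[R]_(m, n)}) : sigma_gen X `<=` measurable.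
Proof.
rewrite /sigma_gen g_sigma_preimageE => _ [B mB <-].
exact: (measurable_funP X).
Qed.

End generated_sigma_algebras.

Section rank_deficiency.
Context d (Omega : measurableType d) (R : realType) (P : probability Omega R).
Variables (D : nat) (f rho : 'cV[R]_D -> R) (L : R).
Hypotheses (fC1 : C1 f) (L0 : 0 < L) (gradL : forall x, enorm (grad f x) <= L).
Hypotheses (rho_density : prob_density rho) (rho_supp : full_support rho).
Variables (lam : seq R) (de : nat).
Hypotheses (slam : spectrum (grad_cov f rho) lam) (de0 : (0 < de)%N).
Hypothesis rC : \rank (grad_cov f rho) = de.
Variables (k : nat) (X : 'I_k -> {RV P >-> 'cV[R]_D}).
Hypothesis X_density : forall j, has_density (X j) rho.
Hypothesis X_indep : independent_family P (fun j => sigma_gen (X j)).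
(** [M] abstracts the sampled covariance: all that matters is that its row space contains every
    sampled gradient. *)
Variable M : Omega -> 'M[R]_D.
Hypothesis M_ker : forall w u, M w *m u = 0 -> forall j, dotv (grad f (X j w)) u = 0.
Hypothesis mM : measurable [set w | (\rank (M w) < de)%N].

Local Notation C := (grad_cov f rho).

(** The k sampled gradients are continued by zeros to a full sequence, as [deflation] expects. *)
Let vs i w : 'cV[R]_D := if insub i is Some j then grad f (X j w) else 0.
Let Q i w := deflation (vs^~ w) i.

Let vsE (j : 'I_k) w : vs j w = grad f (X j w).
Proof. by rewrite /vs valK. Qed.

Let vs0 i w : (k <= i)%N -> vs i w = 0.
Proof. by move=> ki; rewrite /vs insubF // ltnNge ki. Qed.

Let past i : set_system Omega :=
  \bigcup_(j in [set` [set j : 'I_k | (j < i)%N]%SET]) sigma_gen (X j).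

(** The projection after i gradients is a function of the first i sample points alone, hence
    independent of the next one. *)
Let mQ_past i a b : (i <= k)%N ->
  measurable_fun setT (fun w : g_sigma_algebraType (past i) => Q i w a b).
Proof.
move=> ik; apply: measurable_deflation => l c li _ B mB; rewrite setTI.
apply: sub_sigma_algebra; have lk : (l < k)%N := leq_trans li ik.
exists (Ordinal lk); first by rewrite /= inE.
rewrite (_ : _ @^-1` B = ((fun x => grad f x c 0) \o X (Ordinal lk)) @^-1` B).
  exact: sigma_gen_preimage (bdd_measurable_grad fC1 gradL c).1 mB.
by apply/seteqP; split => w /=; rewrite -(vsE (Ordinal lk)).
Qed.

Let bQ i a b : bdd_measurable (fun w => Q i w a b).
Proof.
split; last by exists 1 => w; exact/orth_proj_bounded/orth_proj_deflation.
apply: measurable_deflation => l c _.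
have [lk|kl] := ltnP l k.
  under eq_fun do rewrite (vsE (Ordinal lk)).
  exact: (measurableT_comp (bdd_measurable_grad fC1 gradL c).1).
under eq_fun do rewrite vs0 // mxE; exact: measurable_cst.
Qed.

Let btrQ i : bdd_measurable (fun w => \tr (Q i w)).
Proof. exact: bdd_measurable_sum. Qed.

(** Each gradient is orthogonal to the kernel of C, hence lies in its row space. *)
Let span_rank i w : (\rank (span_seq (vs^~ w) i) <= de)%N.
Proof.
rewrite -rC; apply/mxrankS/sumsmx_subP => j _; rewrite genmxE.
have [jk|kj] := ltnP j k; last by rewrite vs0 // trmx0 sub0mx.
rewrite (vsE (Ordinal jk)); apply: submx_of_ker => u.
move=> /(grad_cov_ker fC1 gradL rho_density u (X_density (Ordinal jk)) rho_supp) gu.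
by apply/colP => c; rewrite !ord1 -dotvE gu mxE.
Qed.

Let de_leD : (de <= D)%N. Proof. by rewrite -rC rank_leq_row. Qed.

Let excess i : R := \int[P]_w \tr (Q i w) - (D - de)%:R.

Let excess_ge0 i : 0 <= excess i.
Proof.
rewrite subr_ge0 -[leLHS](Exp_cst P); apply: le_Exp => //.
  exact: bdd_measurable_cst.
move=> w; apply: le_trans (mxtrace_deflation_ge _ _).
by rewrite natrB // lerD2l lerN2 ler_nat span_rank.
Qed.

(** Independence turns the mean trace drop into E tr (Q_i C) / L^2, and the spectral trace bound
    compares this with the excess itself. *)
Let excessS i : (i < k)%N ->
  excess i.+1 <= (1 - lam`_de.-1 / L ^+ 2) * excess i.
Proof.
move=> ik; pose j := Ordinal ik; have Xrho := X_density j.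
have Csym := grad_cov_sym fC1 gradL rho_density Xrho.
have Cpsd u := grad_cov_psd fC1 gradL rho_density u Xrho.
have step : \int[P]_w \tr (Q i.+1 w) <=
    \int[P]_w \tr (Q i w) - L ^- 2 * \int[P]_w \tr (Q i w *m C).
  rewrite -(Exp_quadratic fC1 gradL rho_density (X := X j)) //; last first.
    move=> a b A B h mh mA mB.
    apply: (independent_family_grouping (G := fun j => sigma_gen (X j))
              (A := [set l : 'I_k | (l < i)%N]%SET) (i := j)) => //.
    - by move=> l; exact: smallest_sigma_algebra.
    - by move=> l; exact: sigma_gen_measurable.
    - by rewrite inE ltnn.
    - by have := mQ_past a b (ltnW ik) measurableT mA; rewrite setTI.
    - exact: sigma_gen_preimage.
  have bq : bdd_measurable (fun w => dotv (grad f (X j w)) (Q i w *m grad f (X j w))).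
    under eq_fun do rewrite dotv_mulmx.
    apply: bdd_measurable_sum => a; apply: bdd_measurable_sum => b.
    apply: bdd_measurableM => //.
    apply: (bdd_measurable_comp (X j) (h := fun x => grad f x a 0 * grad f x b 0)).
    by apply: bdd_measurableM; exact: (bdd_measurable_grad fC1 gradL).
  have bZ := bdd_measurableM (bdd_measurable_cst Omega (- L ^- 2)) bq.
  rewrite -mulNr -ExpZ // -ExpD //; apply: le_Exp => //.
    exact: bdd_measurableD.
  move=> w; rewrite mulNr /Q /= (vsE j); apply: mxtrace_deflate_le => //.
  exact: orth_proj_deflation.
have bound : lam`_de.-1 * excess i <= \int[P]_w \tr (Q i w *m C).
  have bc := bdd_measurable_cst Omega (- (D - de)%:R : R).
  rewrite /excess -(Exp_cst P (- _)) -ExpD // -ExpZ; last exact: bdd_measurableD.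
  apply: le_Exp => [||w].
  - by apply: bdd_measurableM; [exact: bdd_measurable_cst|exact: bdd_measurableD].
  - apply: bdd_measurable_sum => a; under eq_fun do rewrite mxE.
    apply: bdd_measurable_sum => b.
    by apply: bdd_measurableM => //; exact: bdd_measurable_cst.
  by have [] := mxtrace_spectrum_ge Cpsd Csym slam de0 rC (orth_proj_deflation (vs^~ w) i).
rewrite mulrBl mul1r /excess lerBlDr (le_trans step) // -/(excess i).
rewrite addrAC subrK lerD2l lerN2 mulrAC mulrC ler_wpM2l //.
by rewrite invr_ge0 exprn_ge0 // ltW.
Qed.

(** Markov's inequality: if [M w] has rank below [de], so has the span of the gradients, and the
    trace exceeds D - de by at least 1. The mean of this excess starts at [de] and shrinks at each
    gradient. *)
Lemma prob_rank_deficient :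
  (P [set w | (\rank (M w) < de)%N] <=
    (de%:R * expR (- (k%:R * (lam`_de.-1 / L ^+ 2))))%:E)%E.
Proof.
set q := lam`_de.-1 / L ^+ 2.
have decay i : (i <= k)%N -> excess i <= de%:R * expR (- (i%:R * q)).
  elim: i => [_|i IH ik].
    rewrite mul0r oppr0 expR0 mulr1 /excess [X in X - _](_ : _ = D%:R).
      by rewrite natrB // opprB addrC subrK.
    by rewrite -[RHS](Exp_cst P); apply: eq_Rintegral => w _; rewrite /Q /= mxtrace1.
  apply: le_trans (excessS ik) _; rewrite -/q.
  (* The elementary bound 1 - q <= exp (-q), multiplied by a nonnegative excess. *)
  apply: (@le_trans _ _ (expR (- q) * excess i)).
    by rewrite ler_wpM2r // expR_ge1Dx.
  have -> : expR (- (i.+1%:R * q)) = expR (- q) * expR (- (i%:R * q)).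
    by rewrite -natr1 mulrDl mul1r opprD expRD mulrC.
  by rewrite [leRHS]mulrCA ler_wpM2l ?expR_ge0 // IH // ltnW.
apply: le_trans (_ : (excess k)%:E <= _)%E; last by rewrite lee_fin decay.
set A := [set w | _]; have b1 : bdd_measurable (\1_A : Omega -> R).
  split; first exact: measurable_indic.
  by exists 1 => w; rewrite indicE; case: (_ \in _); rewrite ?normr1 ?normr0.
have -> : P A = (\int[P]_w (\1_A w))%:E by rewrite -Exp_EFin // integral_indic // setIT.
have bc := bdd_measurable_cst Omega (- (D - de)%:R : R).
rewrite lee_fin /excess -(Exp_cst P (- _)) -ExpD //; apply: le_Exp => //.
  exact: bdd_measurableD.
move=> w; rewrite indicE natrB //; have tq := mxtrace_deflation_ge (vs^~ w) k.
have := span_rank k w; case: (boolP (w \in A)) => [|_]; rewrite -(ler_nat R) /=; last first.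
  by move=> ?; rewrite /Q; lra.
rewrite inE /A /= => rM _.
have : (\rank (span_seq (vs^~ w) k) <= \rank (M w))%N.
  apply/mxrankS/sumsmx_subP => j _; rewrite genmxE (vsE j); apply: submx_of_ker => u.
  by move=> /M_ker Mu; apply/colP => c; rewrite !ord1 -dotvE Mu mxE.
move=> /leq_ltn_trans /(_ rM); rewrite -(ler_nat R) -natr1 => ?.
by rewrite /Q; lra.
Qed.

End rank_deficiency.

(** * The reduced problem and the histories *)

Section gradient_covariance_geometry.
Context {R : realType} {D : nat}.
Variables (C : 'M[R]_D).
Hypothesis C_sym : C^T = C.

(** For symmetric C the kernels of C and C^2 coincide, since |Cv|^2 = v . CCv; so C factors through
    C^2 and every u splits into a range part and a kernel part. *)
Lemma sym_range_ker (u : 'cV[R]_D) : exists t, C *m (u - C *m t) = 0.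
Proof.
have /submxP[B CB] : (C <= C *m C)%MS.
  apply: submx_of_ker => v CCv; apply/eqP; rewrite -dotvv_eq0 dotvE trmx_mul C_sym.
  by rewrite -mulmxA [C *m (C *m v)]mulmxA CCv mulmx0 mxE.
have CE : C *m C *m B^T = C.
  by rewrite -[RHS]C_sym [in RHS]CB !trmx_mul C_sym.
by exists (B^T *m u); rewrite mulmxBr !mulmxA CE subrr.
Qed.

(** The rank condition upgrades inclusion of ranges to equality, so the affine space p + range A
    meets every coset of the kernel of C. *)
Lemma range_meets_classes n (A : 'M[R]_(D, n)) (x p : 'cV[R]_D) :
  (A^T <= C)%MS -> (\rank C <= \rank A)%N ->
  exists y, C *m (x - (A *m y + p)) = 0.
Proof.
move=> AC rA; have [t ut] := sym_range_ker (x - p).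
have /submxP[B CB] : (C <= A^T)%MS.
  by rewrite -(mxrank_leqif_sup AC).2 eqn_leq mxrankS //= mxrank_tr.
have AB : A *m B^T = C by rewrite -[A]trmxK -trmx_mul -CB C_sym.
by exists (B^T *m t); rewrite mulmxA AB opprD addrA addrAC.
Qed.

End gradient_covariance_geometry.

Section history_measurability.
Context d (Omega : measurableType d) (R : realType) (P : probability Omega R).

Lemma sigma_gen_open (T : topologicalType) (X : Omega -> T) (U : set T) :
  open U -> sigma_gen X (X @^-1` U).
Proof. by move=> oU; apply: sub_sigma_algebra; exists U => //; rewrite setTI. Qed.

Lemma sigma_gen_continuous (T : topologicalType) (X : Omega -> T) (h : T -> R) B :
  continuous h -> measurable B -> sigma_gen X ((h \o X) @^-1` B).
Proof.
move=> ch mB; pose S := preimage_set_system setT X open.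
have : measurable_fun setT (h \o X : g_sigma_algebraType S -> R).
  apply: (measurability _ (RGenOpens.measurableE R)) => _ [_ [a [b ->]] <-].
  rewrite setTI comp_preimage; apply: sigma_gen_open.
  by apply: open_comp => [x _|]; [exact: ch|exact: interval_open].
by move=> /(_ measurableT _ mB); rewrite setTI.
Qed.

Variable D : nat.

(* Entries with a column index beyond the (random) width read as 0. *)
Definition tagged_entry m (a : 'I_m) (l : nat) (t : {n : nat & 'M[R]_(m, n)}) : R :=
  if insub l is Some c then projT2 t a c else 0.

Definition tagged_coord (l : nat) (t : {n : nat & 'cV[R]_n}) : R :=
  if insub l is Some c then projT2 t c 0 else 0.

(** On each summand of the disjoint union this is a coordinate function or constantly 0. *)
Lemma continuous_tagged_entry m (a : 'I_m) l : continuous (tagged_entry a l).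
Proof.
apply/continuousP => U oU; apply/sigT_openP => n.
rewrite -comp_preimage; move: U oU; apply/continuousP.
rewrite /comp /tagged_entry /=; case: insubP => [c _ _|_]; last exact: cst_continuous.
exact: coord_continuous.
Qed.

Lemma continuous_tagged_coord l : continuous (tagged_coord l).
Proof.
apply/continuousP => U oU; apply/sigT_openP => n.
rewrite -comp_preimage; move: U oU; apply/continuousP.
rewrite /comp /tagged_coord /=; case: insubP => [c _ _|_]; last exact: cst_continuous.
exact: coord_continuous.
Qed.

(** Each summand of a disjoint union is open; this makes the random width of A^k measurable for the
    history. *)
Lemma open_tag (X : nat -> topologicalType) n : open [set t : {n : nat & X n} | projT1 t = n].
Proof.
apply/sigT_openP => m.
rewrite (_ : _ @^-1` _ = if m == n then setT else set0); last first.
  by case: eqP => mn; apply/seteqP; split.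
by case: ifP => _; [exact: openT|exact: open0].
Qed.

Lemma open_tagged_mxrank_ge m r :
  open [set t : {n : nat & 'M[R]_(m, n)} | (r <= \rank (projT2 t))%N].
Proof. by apply/sigT_openP => n; exact: open_mxrank_ge. Qed.

Variables (f : 'cV[R]_D -> R) (s : asm_data P D).
Hypothesis fcont : continuous f.

(** The width of A^i is random, so the event is cut according to its countably many values; on each
    piece x^i is a sum of fixed length. *)
Lemma F_full_sublevel k i c : (1 <= i <= k)%N ->
  F_full s k [set w | f (asm_x s i w) <= c].
Proof.
move=> /andP[i1 ik].
pose gens := \bigcup_(i in [set i | (1 <= i <= k)%N]) sigma_gen (tagged_A s i) `|`
      \bigcup_(i in [set i | (1 <= i <= k)%N]) sigma_gen (tagged_y s i) `|`
      \bigcup_(i in [set i | (i <= k)%N]) sigma_gen (asm_p s i).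
pose T := g_sigma_algebraType gens.
have FA B : sigma_gen (tagged_A s i) B -> (measurable : set_system T) B.
  by move=> sB; apply: sub_sigma_algebra; left; left; exists i => //=; rewrite i1.
have FY B : sigma_gen (tagged_y s i) B -> (measurable : set_system T) B.
  by move=> sB; apply: sub_sigma_algebra; left; right; exists i => //=; rewrite i1.
have FP B : sigma_gen (asm_p s i.-1) B -> (measurable : set_system T) B.
  move=> sB; apply: sub_sigma_algebra; right; exists i.-1 => //=.
  by rewrite (leq_trans (leq_pred i)).
(* The product truncated at a deterministic width n; it equals x^i where n is the actual width. *)
pose x n w : 'cV[R]_D := \col_a (\sum_(0 <= l < n)
  tagged_entry a l (tagged_A s i w) * tagged_coord l (tagged_y s i w)) + asm_p s i.-1 w.
have mx n : measurable_fun setT (x n : T -> 'cV[R]_D).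
  apply: measurable_fun_mx => a b; rewrite ord1 {b}.
  under eq_fun do rewrite mxE mxE.
  apply: measurable_funD.
    apply: measurable_fun_sum_fin => l; apply: measurable_funM.
      move=> _ B mB; rewrite setTI; apply: FA.
      exact: (sigma_gen_continuous (X := tagged_A s i) (@continuous_tagged_entry _ a l) mB).
    move=> _ B mB; rewrite setTI; apply: FY.
    exact: (sigma_gen_continuous (X := tagged_y s i) (@continuous_tagged_coord l) mB).
  move=> _ B mB; rewrite setTI; apply: FP.
  exact: (sigma_gen_continuous (X := asm_p s i.-1) (@coord_continuous R D 1 a 0) mB).
have xE w : x (asm_dim s i w) w = asm_x s i w.
  apply/colP => a; rewrite mxE mxE [RHS]mxE; congr (_ + _).
  rewrite big_mkord [RHS]mxE; apply: eq_bigr => l _.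
  by rewrite /tagged_entry /tagged_coord /= valK.
have -> : [set w | f (asm_x s i w) <= c] = \bigcup_n
    ([set w | asm_dim s i w = n] `&` [set w | f (x n w) <= c]).
  apply/seteqP; split => [w fw|w [n _ [/= <-]]]; last by rewrite xE.
  by exists (asm_dim s i w) => //; split => //=; rewrite xE.
suff : (measurable : set_system T) (\bigcup_n
    ([set w | asm_dim s i w = n] `&` [set w | f (x n w) <= c])) by [].
apply: bigcupT_measurable => n; apply: measurableI.
  apply: FA.
  pose U : set {m : nat & 'M[R]_(D, m)} := [set t | projT1 t = n].
  have oU : open U by exact: (@open_tag (fun m => 'M[R]_(D, m) : topologicalType) n).
  exact: (sigma_gen_open (X := tagged_A s i) oU).
have mf : measurable_fun setT (f \o x n : T -> R).
  exact: (measurableT_comp (continuous_measurable_mx fcont) (mx n)).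
have := mf measurableT _ (measurable_itv `]-oo, c]%R).
by rewrite setTI.
Qed.

End history_measurability.

(** * Lower bounds from conditional probabilities *)

Lemma cond_probability_measurable d (Omega : measurableType d) (R : realType)
    (P : probability Omega R) (G : set_system Omega) (S : set Omega) (Z : Omega -> R) :
  cond_probability P G S Z -> measurable S.
Proof.
move=> [iS _ _ _].
have /measurable_EFinP m1 := measurable_int _ iS.
have := m1 measurableT _ (measurable_set1 (1 : R)).
rewrite setTI (_ : _ @^-1` _ = S) //; apply/seteqP; split => w /=; rewrite indicE.
  by case: (boolP (w \in S)) => [/set_mem //|_ /eqP]; rewrite eq_sym oner_eq0.
by move=> Sw; rewrite mem_set.
Qed.

Lemma cond_probability_lb d (Omega : measurableType d) (R : realType)
    (P : probability Omega R) (G : set_system Omega) (S E : set Omega) Z (gamma : R) :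
  0 <= gamma -> G `<=` measurable -> cond_probability P G S Z ->
  {ae P, forall w, gamma <= Z w} -> G E -> (gamma%:E * P E <= P (E `&` S))%E.
Proof.
move=> gamma0 mG SZ gZ GE; have mE := mG _ GE; have mS := cond_probability_measurable SZ.
have [iS iZ _ ZE] := SZ.
have -> : P (E `&` S) = (\int[P]_(w in E) (Z w)%:E)%E.
  by rewrite ZE // integral_indic // setIC.
have mZ : measurable_fun E Z.
  by apply: measurable_funTS; apply/measurable_EFinP; exact: measurable_int iZ.
rewrite -integral_cst //.
(* Replacing Z by its maximum with gamma alters it on a null set only and makes the bound hold
   pointwise. *)
have mmax : measurable_fun E (fun w => (Num.max gamma (Z w))%:E).
  by apply/measurable_EFinP; apply: measurable_maxr.
rewrite [leRHS](@ae_eq_integral _ _ _ _ _ (fun w => (Num.max gamma (Z w))%:E)) //.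
- by apply: ge0_le_integral => // w _; rewrite lee_fin ?le_max ?lexx.
- exact/measurable_EFinP.
by apply: filterS gZ => w gZw _; rewrite max_r.
Qed.

(** * Histories, sampled covariances and the reduced infimum *)

Section histories.
Context d (Omega : measurableType d) (R : realType) (P : probability Omega R).
Variables (D : nat) (f rho : 'cV[R]_D -> R) (s : asm_data P D).

Lemma F_full_half k : F_full s k.-1 `<=` F_half s k.
Proof.
apply: sub_sigma_algebra2 => B [[[i /= /andP[i1 ik] Bi]|[i ik Bi]]|[i ik Bi]].
- left; left; exists i => //=; rewrite i1 (leq_trans ik) ?leq_pred //.
- by left; right; exists i.
- by right; exists i.
Qed.

Hypothesis algo : asm_go f rho s.

Lemma sigma_history_measurable a b c : sigma_history s a b c `<=` measurable.
Proof.
apply: smallest_sub; first exact: sigma_algebra_measurable.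
move=> B [[[i /= /andP[i1 _] Bi]|[i /= /andP[i1 _] Bi]]|[i _ Bi]].
- exact: (asm_A_measurable algo i1).
- exact: (asm_y_measurable algo i1).
- exact: (sigma_gen_measurable (X := asm_p s i)).
Qed.

(** The form u . C_hat u is an average of squared slopes, so it vanishes only if each of them
    does. *)
Lemma C_hat_ker k w u : C_hat f s k w *m u = 0 ->
  forall j : 'I_k, dotv (grad f (asm_sample s j w)) u = 0.
Proof.
move=> Cu j; have k0 : (0 < k)%N by case: k j Cu => // -[].
pose g (j : 'I_k) := grad f (asm_sample s j w).
have : dotv u (C_hat f s k w *m u) = k%:R^-1 * \sum_(j < k) (dotv (g j) u) ^+ 2.
  rewrite /C_hat -scalemxAl dotvZr mulmx_suml dotv_sumr; congr (_ * _).
  apply: eq_bigr => i _; rewrite -mulmxA [_^T *m u]mx11_scalar mul_mx_scalar.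
  by rewrite dotvZr -dotvE [dotv u _]dotvC expr2.
rewrite Cu /dotv big1 => [|i _]; last by rewrite mxE mulr0.
move=> /esym/eqP; rewrite mulf_eq0 invr_eq0 pnatr_eq0 eqn0Ngt k0 /=.
rewrite psumr_eq0 => [/allP /(_ j (mem_index_enum j))|i _]; last exact: sqr_ge0.
by rewrite sqrf_eq0 => /eqP.
Qed.

Lemma C_hat_sym k w : (C_hat f s k w)^T = C_hat f s k w.
Proof.
rewrite /C_hat linearZ linear_sum; congr (_ *: _); apply: eq_bigr => i _.
by rewrite /= trmx_mul trmxK.
Qed.

Lemma C_hat_sub (C : 'M[R]_D) k w :
  (forall u, C *m u = 0 -> forall x, dotv (grad f x) u = 0) -> (C_hat f s k w <= C)%MS.
Proof.
move=> Cker; apply: submx_of_ker => u /Cker gu.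
rewrite /C_hat -scalemxAl mulmx_suml big1 ?scaler0 // => i _.
by rewrite -mulmxA [_^T *m u]mx11_scalar -dotvE gu mul_mx_scalar scale0r.
Qed.

Lemma sigma_sample_rank k r :
  (forall a, measurable_fun setT (fun x => grad f x a 0)) ->
  sigma_sample s k [set w | (r <= \rank (C_hat f s k w))%N].
Proof.
move=> mg; pose T := g_sigma_algebraType (\bigcup_(j in [set: 'I_k]) sigma_gen (asm_sample s j)).
suff : (measurable : set_system T) [set w | (r <= \rank (C_hat f s k w))%N] by [].
apply: measurable_mxrank_ge => a b.
have -> : (fun w => C_hat f s k w a b) = (fun w => k%:R^-1 * \sum_(j < k)
    (grad f (asm_sample s j w) a 0 * grad f (asm_sample s j w) b 0)).
  apply/funext => w; rewrite /C_hat mxE summxE; congr (_ * _); apply: eq_bigr => j _.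
  by rewrite [LHS]mxE big_ord1; congr (_ * _); rewrite mxE.
apply: measurable_funM; first exact: measurable_cst.
have mgj c (j : 'I_k) : measurable_fun setT (fun w : T => grad f (asm_sample s j w) c 0).
  move=> _ B mB; rewrite setTI; apply: sub_sigma_algebra; exists j => //.
  exact: (sigma_gen_preimage (X := asm_sample s j) (mg c) mB).
by apply: measurable_fun_sum_fin => j; apply: measurable_funM; exact: mgj.
Qed.

Lemma mxrank_asm_A k w : (0 < k)%N -> \rank (asm_A s k w) = \rank (C_hat f s k w).
Proof.
by move=> k0; rewrite -mxrank_tr (asm_A_range algo w k0) mxrank_tr.
Qed.

(** The rank can be read off A^k. The same event is thus known at the half step, for conditioning,
    and determined by the new sample, for independence of the past. *)
Lemma F_half_rank k r : (0 < k)%N ->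
  F_half s k [set w | (r <= \rank (C_hat f s k w))%N].
Proof.
move=> k0; apply: sub_sigma_algebra; left; left; exists k; first by rewrite /= k0 leqnn.
rewrite (_ : [set w | _] = tagged_A s k @^-1`
    [set t : {n : nat & 'M[R]_(D, n)} | (r <= \rank (projT2 t))%N]).
  exact: (sigma_gen_open (X := tagged_A s k) (@open_tagged_mxrank_ge _ D r)).
by apply/seteqP; split => w /=; rewrite mxrank_asm_A.
Qed.

(** With full rank, the affine search space contains a point congruent to a global minimizer modulo
    the kernel of C, along which f is invariant. *)
Lemma fmin_le_min (C : 'M[R]_D) fstar k w : (forall x, differentiable f x) ->
  C^T = C -> (forall u, C *m u = 0 -> forall x, dotv (grad f x) u = 0) ->
  global_min f fstar -> (0 < k)%N -> (\rank C <= \rank (C_hat f s k w))%N ->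
  fmin f s k w <= fstar.
Proof.
move=> df Cs Cker [[x <-] fmin_lb] k0 rC.
have AC : ((asm_A s k w)^T <= C)%MS.
  by rewrite (asm_A_range algo w k0) C_hat_sym; exact: C_hat_sub.
have [|y Cy] := range_meets_classes Cs x (asm_p s k.-1 w) AC.
  by rewrite mxrank_asm_A.
have <- : f (asm_A s k w *m y + asm_p s k.-1 w) = f x.
  rewrite -[RHS](invariant_of_grad_orth df (v := asm_A s k w *m y + asm_p s k.-1 w - x)).
    by rewrite [x + _]addrC subrK.
  by apply: Cker; rewrite -opprB mulmxN Cy oppr0.
apply: ge_inf; last by exists y.
by exists (f x) => _ [z _ <-].
Qed.

End histories.

(** * The constants *)

Section constants.
Context {R : realType}.
Variables (lam : seq R) (de : nat) (L : R).
Hypotheses (lde0 : 0 < lam`_de.-1) (lde_le : lam`_de.-1 <= lam`_0) (L0 : 0 < L) (de0 : (0 < de)%N).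

Local Notation a := (lam`_de.-1 ^+ 2 / (4 * lam`_0 * L ^+ 2)).

Let lam0 : 0 < lam`_0. Proof. exact: lt_le_trans lde_le. Qed.

Let a0 : 0 < a.
Proof. by rewrite divr_gt0 ?exprn_gt0 // !mulr_gt0 // exprn_gt0. Qed.

Lemma tau_itv : 0 < tau lam de L <= 1.
Proof.
by rewrite /tau subr_gt0 expR_lt1 oppr_lt0 a0 /= gerBl expR_ge0.
Qed.

Lemma M0_ge1 : (1 <= M0 lam de L)%R.
Proof.
rewrite /M0 lerDr -(ler_int R) /= (le_trans _ (ceil_ge _)) //.
by rewrite mulr_ge0 ?ln_ge0 ?ler1n // divr_ge0 ?exprn_ge0 ?mulr_ge0 ?exprn_ge0 // ltW.
Qed.

(** With a as above, 1 - tau = exp (-a), and the choice of [M0] gives k a >= ln de + a; the true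
    decay rate is at least a. *)
Lemma rank_deficiency_le_tau k : (M0 lam de L <= k%:Z)%R ->
  de%:R * expR (- (k%:R * (lam`_de.-1 / L ^+ 2))) <= 1 - tau lam de L.
Proof.
move=> kM; rewrite /tau opprB addrC subrK.
(* This reduces to lambda_de <= 4 lambda_1. *)
have aq : a <= lam`_de.-1 / L ^+ 2.
  rewrite invfM mulrA ler_wpM2r ?invr_ge0 ?exprn_ge0 ?(ltW L0) //.
  rewrite ler_pdivrMr ?mulr_gt0 // expr2 ler_wpM2l ?(ltW lde0) //.
  by have := lde_le; have := lam0; lra.
have ka : ln (de%:R : R) + a <= k%:R * a.
  have : (M0 lam de L)%:~R <= (k%:R : R) by rewrite -[k%:R]/(k%:Z%:~R) ler_int.
  rewrite /M0 intrD => kM'.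
  have := ceil_ge (4 * lam`_0 * L ^+ 2 / lam`_de.-1 ^+ 2 * ln (de%:R : R)) => c.
  have {c kM'} : 4 * lam`_0 * L ^+ 2 / lam`_de.-1 ^+ 2 * ln (de%:R : R) + 1 <= k%:R by lra.
  rewrite -(ler_pM2r a0) mulrDl mul1r; apply: le_trans.
  rewrite lerD2r le_eqVlt; apply/orP; left; apply/eqP.
  by field; rewrite !gt_eqF.
have deE : (de%:R : R) = expR (ln de%:R) by rewrite lnK // posrE ltr0n.
rewrite [X in X * _]deE -expRD ler_expR.
have : (k%:R : R) * a <= k%:R * (lam`_de.-1 / L ^+ 2) by rewrite ler_wpM2l.
lra.
Qed.

End constants.

(** * Iterates outside the sublevel set *)

Section missing_the_sublevel_set.
Context d (Omega : measurableType d) (R : realType) (P : probability Omega R).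
Variables (D : nat) (f rho : 'cV[R]_D -> R) (de : nat) (fstar L : R).
Variables (lam : seq R) (s : asm_data P D) (eps gamma : R).
Hypotheses (fC1 : C1 f) (f_de : effective_dim f de) (de0 : (1 <= de)%N).
Hypotheses (f_min : global_min f fstar) (L0 : 0 < L).
Hypothesis gradL : forall x, enorm (grad f x) <= L.
Hypotheses (rho_density : prob_density rho) (rho_supp : full_support rho).
Hypotheses (slam : spectrum (grad_cov f rho) lam) (algo : asm_go f rho s).
Hypothesis gamma_itv : 0 < gamma <= 1.
Hypothesis success_prob : forall k, (1 <= k)%N -> exists Z : Omega -> R,
    [/\ cond_probability P (F_half s k) [set w | success f s eps k w = 1] Z,
        cond_expectation P (F_half s k) (success f s eps k) Z &
        {ae P, forall w, gamma <= Z w}].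

Local Notation C := (grad_cov f rho).

(** The single sample point of step 1 serves as a random vector of density rho, through which the
    facts about C are obtained. *)
Let Xrho : has_density (asm_sample s (ord0 : 'I_1)) rho := asm_sample_density algo ord0.
Let C_sym := grad_cov_sym fC1 gradL rho_density Xrho.
Let C_psd v := grad_cov_psd fC1 gradL rho_density v Xrho.
Let C_ker v := grad_cov_ker fC1 gradL rho_density v Xrho rho_supp.
Let C_rank : \rank C = de := mxrank_effective_dim fC1.1 C_sym C_ker f_de.

Lemma spectral_gap : 0 < lam`_de.-1 /\ lam`_de.-1 <= lam`_0.
Proof. by have [] := mxtrace_spectrum_ge C_psd C_sym slam de0 C_rank orth_proj1. Qed.

Let fcont : continuous f.
Proof. by move=> x; apply: differentiable_continuous; exact: fC1.1. Qed.

Definition missed k := [set w | forall i, (1 <= i <= k)%N -> fstar + eps < f (asm_x s i w)].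

Lemma F_full_missed k : F_full s k (missed k).
Proof.
pose gens := \bigcup_(i in [set i | (1 <= i <= k)%N]) sigma_gen (tagged_A s i) `|`
      \bigcup_(i in [set i | (1 <= i <= k)%N]) sigma_gen (tagged_y s i) `|`
      \bigcup_(i in [set i | (i <= k)%N]) sigma_gen (asm_p s i).
pose T := g_sigma_algebraType gens.
suff : (measurable : set_system T) (missed k) by [].
rewrite (_ : missed k = \bigcap_i (if (1 <= i <= k)%N then
    ~` [set w | f (asm_x s i w) <= fstar + eps] else setT)); last first.
  apply/seteqP; split => [w mw i _|w mw i ik].
    by case: ifP => // ik /=; apply/negP; rewrite -ltNge; exact: mw.
  by have := mw i I; rewrite ik /= => /negP; rewrite -ltNge.
apply: bigcapT_measurable => i; case: ifP => ik //.
by apply: measurableC; exact: F_full_sublevel.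
Qed.

Lemma measurable_missed k : measurable (missed k).
Proof. exact: (sigma_history_measurable algo (@F_full_missed k)). Qed.

(** From the runs that missed so far one may remove those with full rank and a successful solve,
    which have probability at least gamma P(missed k) P(full rank). *)
Lemma prob_missedS k :
  fine (P (missed k.+1)) <= fine (P (missed k)) *
    (1 - gamma * (1 - de%:R * expR (- (k.+1%:R * (lam`_de.-1 / L ^+ 2))))).
Proof.
have [Z [SZ _ gZ]] := success_prob (ltn0Sn k).
pose S := [set w | success f s eps k.+1 w = 1].
pose Rk := [set w | (de <= \rank (C_hat f s k.+1 w))%N].
have mS : measurable S := cond_probability_measurable SZ.
have FR : F_half s k.+1 Rk by exact: (F_half_rank algo).
have mR : measurable Rk := sigma_history_measurable algo FR.
have mB := measurable_missed k.
(* Past misses and full rank are both known before y^(k+1) is drawn, so the conditional bound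
   integrates over their intersection. *)
have FE : F_half s k.+1 (missed k `&` Rk).
  apply: (@measurableI _ (g_sigma_algebraType _) (missed k) Rk) => //.
  by apply: (@F_full_half _ _ _ _ _ _ k.+1); exact: F_full_missed.
have mBR : measurable (missed k `&` Rk) by exact: measurableI.
have mBRS : measurable (missed k `&` Rk `&` S) by exact: measurableI.
have [g0 _] := andP gamma_itv.
have hit := cond_probability_lb (ltW g0) (@sigma_history_measurable _ _ _ _ _ _ _ _ algo _ _ _) SZ gZ FE.
have indep : P (missed k `&` Rk) = (P (missed k) * P Rk)%E.
  rewrite setIC muleC; apply: (asm_sample_past algo (ltn0Sn k)); last exact: F_full_missed.
  by apply: sigma_sample_rank => c; exact: (bdd_measurable_grad fC1 gradL c).1.
have split_miss : (P (missed k.+1) + P (missed k `&` Rk `&` S) <= P (missed k))%E.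
  rewrite -measureU //.
  - apply: le_measure; rewrite ?inE //.
      by apply: measurableU; [exact: measurable_missed|].
    move=> w [mw i /andP[i1 ik]|[[]]] //; apply: mw.
    by rewrite i1 (leq_trans ik).
  - exact: measurable_missed.
  (* Disjointness: full rank brings the reduced infimum down to [fstar], so a success at step k + 1
     contradicts a miss there. *)
  apply/seteqP; split => // w [mw [[_ Rw] Sw]].
  have := mw k.+1; rewrite leqnn /= => /(_ isT).
  apply/negP; rewrite -leNgt.
  have fm := fmin_le_min (w := w) algo fC1.1 C_sym (fun u => (C_ker u).1) f_min (ltn0Sn k).
  rewrite C_rank in fm; apply: le_trans (_ : _ <= fmin f s k.+1 w + eps) _; last by rewrite lerD2r fm.
  move: Sw; rewrite /S /success /= indicE; case: (boolP (_ \in _)) => [/set_mem //|_ /eqP].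
  by rewrite eq_sym oner_eq0.
have rank_prob :
    ((1 - de%:R * expR (- (k.+1%:R * (lam`_de.-1 / L ^+ 2))))%R%:E <= P Rk)%E.
  have mRc : measurable [set w | (\rank (C_hat f s k.+1 w) < de)%N].
    rewrite (_ : [set w | _] = ~` Rk); first exact: measurableC.
    by apply/seteqP; split => w /=; rewrite ltnNge => /negP.
  have := prob_rank_deficient fC1 L0 gradL rho_density rho_supp slam de0 C_rank
    (fun j => asm_sample_density algo j) (asm_sample_independent algo (k := k.+1))
    (@C_hat_ker _ _ _ _ _ f s k.+1) mRc.
  rewrite (_ : [set w | _] = ~` Rk); last first.
    by apply/seteqP; split => w /=; rewrite ltnNge => /negP.
  rewrite probability_setC // -[P Rk]fineK ?fin_num_measure // -EFinB !lee_fin => ?; lra.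
have Pfin A : measurable A -> P A = (fine (P A))%:E by move=> mA; rewrite fineK ?fin_num_measure.
have mM1 := measurable_missed k.+1.
move: hit split_miss rank_prob indep.
rewrite (Pfin _ mBRS) (Pfin _ mBR) (Pfin _ mB) (Pfin _ mR) (Pfin _ mM1).
rewrite -!EFinM -EFinD !lee_fin => hit spl rk [ind].
have b0 : 0 <= fine (P (missed k)) by exact: fine_ge0.
rewrite ind in hit.
have : fine (P (missed k)) * gamma * (1 - de%:R * expR (- (k.+1%:R * (lam`_de.-1 / L ^+ 2)))) <=
    fine (P (missed k)) * gamma * fine (P Rk).
  by rewrite ler_wpM2l // mulr_ge0 // ltW.
rewrite mulrBr mulr1; nra.
Qed.

(** Here m = M0 - 1, so each of the j steps after m has index at least [M0] and contributes a factor
    1 - gamma tau <= exp (- gamma tau). *)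
Lemma prob_missed_le (m j : nat) : m.+1%:Z = M0 lam de L ->
  fine (P (missed (m + j))) <= expR (- (tau lam de L * gamma * j%:R)).
Proof.
move=> mM0; have [lde0 lde_le] := spectral_gap.
have [g0 g1] := andP gamma_itv; have [t0 t1] := andP (tau_itv lde0 lde_le L0).
elim: j => [|j IH].
  rewrite mulr0 oppr0 expR0 addn0 -lee_fin fineK ?fin_num_measure //.
    exact: probability_le1 (measurable_missed m).
  exact: measurable_missed.
rewrite addnS; apply: le_trans (prob_missedS _) _.
apply: (@le_trans _ _ (expR (- (tau lam de L * gamma * j%:R)) * (1 - gamma * tau lam de L))).
  apply: ler_pM => //; first exact: fine_ge0.
    have e0 : 0 <= de%:R * expR (- ((m + j).+1%:R * (lam`_de.-1 / L ^+ 2))) :> R.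
      by rewrite mulr_ge0 ?expR_ge0.
    nra.
  have := rank_deficiency_le_tau lde0 lde_le L0 de0 (k := (m + j).+1).
  by rewrite -mM0 lez_nat ltnS leq_addr => /(_ isT) ?; nra.
rewrite -natr1 [_ * (_ + 1)]mulrDr mulr1 opprD expRD ler_wpM2l ?expR_ge0 //.
by rewrite [gamma * _]mulrC expR_ge1Dx.
Qed.

End missing_the_sublevel_set.

(** * From missed iterates to convergence *)

Section best_iterate.
Context d (Omega : measurableType d) (R : realType) (P : probability Omega R).
Variables (D : nat) (f : 'cV[R]_D -> R) (s : asm_data P D) (fstar eps : R).

Lemma best_iterate_sublevel (xopt : nat -> Omega -> 'cV[R]_D) k : (0 < k)%N ->
  best_iterate f s xopt ->
  [set w | f (xopt k w) <= fstar + eps] = ~` missed f fstar s eps k.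
Proof.
move=> k0 best; apply/seteqP; split => w /=.
  have [[i ik ->] _] := best k w k0 => fi mw.
  by have := mw i ik; rewrite ltNge fi.
move=> nm; rewrite leNgt; apply/negP => lt; apply: nm => i ik.
have [_ /(_ i ik)] := best k w k0; exact: lt_le_trans.
Qed.

End best_iterate.

Lemma cvg_probability1 d (Omega : measurableType d) (R : realType)
    (P : probability Omega R) (A : nat -> set Omega) :
  (forall xi : R, 0 < xi < 1 -> \forall k \near \oo, (xi%:E <= P (A k))%E) ->
  (forall k, (0 < k)%N -> measurable (A k)) ->
  P (A k) @[k --> \oo] --> 1%E.
Proof.
move=> PA mA.
have fin k : (0 < k)%N -> P (A k) \is a fin_num by move=> k0; rewrite fin_num_measure //; exact: mA.
apply/fine_cvgP; split; first by exists 1%N => // k /=; exact: fin.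
(* The minimum with 1/2 keeps the level inside (0, 1) when e is large. *)
apply/cvgrPdist_le => e e0; pose xi := 1 - Num.min e (1 / 2).
have xi01 : 0 < xi < 1.
  have : 0 < Num.min e (1 / 2) by rewrite lt_min e0 divr_gt0.
  have : Num.min e (1 / 2) <= 1 / 2 by rewrite ge_min lexx orbT.
  by rewrite /xi => ? ?; apply/andP; split; lra.
have e_xi : 1 - e <= xi by rewrite /xi lerD2l lerN2 ge_min lexx.
near=> k; have k0 : (0 < k)%N by near: k; exact: nbhs_infty_gt.
have /= P1 : (P (A k) <= 1)%E by exact: probability_le1 (mA _ k0).
have Pxi : (xi%:E <= P (A k))%E by near: k; exact: PA.
move: P1 Pxi; rewrite -(fineK (fin _ k0)) !lee_fin /= => P1 Pxi.
by rewrite ger0_norm ?subr_ge0 //; lra.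
Unshelve. all: by end_near. Qed.

Theorem theorem4p8 (R : realType) (d : measure_display)
    (Omega : measurableType d) (P : probability Omega R)
    (D : nat) (f : 'cV[R]_D -> R) (de : nat) (fstar L : R)
    (rho : 'cV[R]_D -> R) (lam : seq R) (s : asm_data P D)
    (xopt : nat -> Omega -> 'cV[R]_D) (eps gamma : R) :
  (1 <= D)%N ->
  C1 f ->
  effective_dim f de -> (1 <= de)%N ->
  global_min f fstar ->
  0 < L -> (forall x, enorm (grad f x) <= L) ->
  prob_density rho -> full_support rho ->
  spectrum (grad_cov f rho) lam ->
  asm_go f rho s ->
  best_iterate f s xopt ->
  0 < eps ->
  0 < gamma <= 1 ->
  (forall k, (1 <= k)%N -> exists Z : Omega -> R,
    [/\ cond_probability P (F_half s k) [set w | success f s eps k w = 1] Z,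
        cond_expectation P (F_half s k) (success f s eps k) Z &
        {ae P, forall w, gamma <= Z w}]) ->
  [/\ P [set w | sublevel f (fstar + eps) (xopt k w)] @[k --> \oo] --> 1%E,
      P [set w | f (xopt k w) <= fstar + eps] @[k --> \oo] --> 1%E &
      forall xi : R, 0 < xi < 1 ->
        forall k : nat, K_xi lam de L gamma xi <= k%:Z ->
          P [set w | sublevel f (fstar + eps) (xopt k w)] =
            P [set w | f (xopt k w) <= fstar + eps] /\
          (xi%:E <= P [set w | sublevel f (fstar + eps) (xopt k w)])%E].
Proof.
move=> _ fC1 fde de0 fm L0 gL rd rs slam algo best eps0 gi succ.
have [g0 _] := andP gi.
have [lde0 lde_le] := spectral_gap fC1 fde de0 gL rd rs slam algo.
have [t0 _] := andP (tau_itv lde0 lde_le L0).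
have tg0 : 0 < tau lam de L * gamma by exact: mulr_gt0.
have [m mM0] : exists m : nat, m.+1%:Z = M0 lam de L.
  have := M0_ge1 lde0 lde_le L0 de0; set M := M0 _ _ _ => M1.
  by exists `|M - 1|%N; lia.
pose hit k := [set w | f (xopt k w) <= fstar + eps].
have hitE k : (0 < k)%N -> hit k = ~` missed f fstar s eps k.
  by move=> k0; exact: best_iterate_sublevel.
have mhit k : (0 < k)%N -> measurable (hit k).
  by move=> /hitE ->; apply: measurableC; exact: (measurable_missed fstar eps fC1 algo).
have bound (xi : R) k : 0 < xi < 1 -> K_xi lam de L gamma xi <= k%:Z -> (xi%:E <= P (hit k))%E.
  move=> /andP[xi0 xi1]; rewrite /K_xi -mM0.
  set c := Num.ceil _ => Kk.
  (* K_xi = c + m, and c >= 1 because |ln (1 - xi)| > 0; hence k exceeds m and k - m >= c. *)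
  have c0 : (0 < c)%R.
    rewrite -(ltr_int R) (lt_le_trans _ (ceil_ge _)) // divr_gt0 // normr_gt0.
    by rewrite lt_eqF // ln_lt0 // subr_gt0 xi1 /= gtrBl.
  have mk : (m < k)%N by lia.
  have ck : (c%:~R <= (k - m)%:R :> R).
    by rewrite -[X in _ <= X]/((k - m)%:Z%:~R) ler_int; lia.
  rewrite hitE ?(leq_ltn_trans _ mk) // probability_setC; last first.
    exact: (measurable_missed fstar eps fC1 algo).
  rewrite -[P _]fineK ?fin_num_measure //; last exact: (measurable_missed fstar eps fC1 algo).
  rewrite -EFinB lee_fin.
  have := prob_missed_le fC1 fde de0 fm L0 gL rd rs slam algo gi succ (k - m) mM0.
  rewrite subnKC ?(ltnW mk) // => /le_trans b.
  (* It remains that tau gamma (k - m) >= |ln (1 - xi)|, which the ceiling c guarantees. *)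
  suff /b : expR (- (tau lam de L * gamma * (k - m)%:R)) <= 1 - xi by move=> ?; lra.
  have xi1' : 0 < 1 - xi by rewrite subr_gt0.
  rewrite -[leRHS]lnK // ler_expR lerNl -(ltr0_norm (x := ln (1 - xi))); last first.
    by rewrite ln_lt0 // xi1' gtrBl.
  rewrite mulrC -ler_pdivrMr //; exact: le_trans (ceil_ge _) ck.
have cvg_hit : P (hit k) @[k --> \oo] --> 1%E.
  apply: cvg_probability1 => // xi xi01.
  exists `|K_xi lam de L gamma xi|%N => // k /= Kk; apply: bound => //.
  by rewrite (le_trans (ler_norm _)) // -abszE lez_nat.
(* Membership in [sublevel] unfolds to the inequality defining [hit], so the two displayed events
   are the same set. *)
by split=> // xi xi01 k Kk; split=> //; exact: bound.
Qed.
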